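(* Let $(D_n)_{n\ge1}$ be connected regular domains of the family $\mathcal D$ such that $x_0\in D_1$, $D_n\Subset D_{n+1}$ for all $n$, and $D=\bigcup_{n\ge1}D_n$, and suppose that for every $n$ the relative kernel $K_{D_n}$ has a jointly continuous version on $D_n\times\partial D_n$ (this version is used). Let $D^K$ be a compact metrizable compactification of $D$, $\partial_{\mathrm m}^KD\subseteq D^K\setminus D$ a Borel set, and $\kappa:\partial_{\mathrm m}^KD\to\mathcal E(D)$ a Borel bijection; write $K_D(x,\eta)=\kappa(\eta)(x)$. Assume that there are $n_1<n_2<\cdots$ (one sequence for all $\eta$) such that $K_D(\cdot,\eta)\,\omega_{x_0}^{D_{n_j}}\Longrightarrow\delta_\eta$ weakly on $D^K$ for every $\eta\in\partial_{\mathrm m}^KD$. Fix such a sequence and relabel $(D_{n_j})_j$ as $(D_n)_n$ (if the convergence holds along the full original sequence, the original sequence is kept). Let $D^G$ be any compact metrizable compactification of $D$, let $\widehat D=D^G\vee D^K$ with projection $p_K:\widehat D\to D^K$, and put $\widehat\partial_{\mathrm m}D=p_K^{-1}(\partial_{\mathrm m}^KD)$ and $\widehat K_D(x,\widehat\eta)=K_D(x,p_K(\widehat\eta))$. Let $u>0$ be harmonic on $D$, put $d\lambda_n^u=u\,d\omega_{x_0}^{D_n}$ (measures on $\partial D_n$, regarded as measures on $\widehat D$), and let $\widehat\mu_u$ be any weak limit on $\widehat D$ of a subsequence of $(\lambda_n^u)$. Then: 1. $\mu_u:=(p_K)_\#\widehat\mu_u$ is the unique finite positive Borel measure on $\partial_{\mathrm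 m}^KD$ satisfying $$u(x)=\int_{\partial_{\mathrm m}^KD}K_D(x,\eta)\,d\mu_u(\eta)\quad(x\in D),\qquad\text{and}\quad \mu_u(\partial_{\mathrm m}^KD)=u(x_0).$$ 2. Conversely, every finite nonzero positive Borel measure $\nu$ on $\partial_{\mathrm m}^KD$ defines a positive harmonic function on $D$ by $x\mapsto\int_{\partial_{\mathrm m}^KD}K_D(x,\eta)\,d\nu(\eta)$. 3. A finite positive Radon measure $\widehat\nu$ on $\widehat D$, carried by $\widehat\partial_{\mathrm m}D$, represents $u$ through $\widehat K_D$, i.e. $u(x)=\int_{\widehat\partial_{\mathrm m}D}\widehat K_D(x,\widehat\eta)\,d\widehat\nu(\widehat\eta)$ for all $x\in D$, if and only if $(p_K)_\#\widehat\nu=\mu_u$. In particular, all weak limits of $(\lambda_n^u)$ on $\widehat D$ have the same push-forward under $p_K$. 4. $(p_K)_\#\lambda_n^u\Longrightarrow\mu_u$ weakly on $D^K$; equivalently, $\lambda_n^u\Longrightarrow\mu_u$ when $\lambda_n^u$ is regarded as a measure on $D^K$. 5. $\lambda_n^u(\widehat D)=u(x_0)$ and $B_n(x):=\int_{\partial D_n}K_{D_n}(x,y)\,d\lambda_n^u(y)=u(x)$ for $x\in D_n$; consequently $B_n\to u$ locally uniformly on $D$.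
   Context: Let $X$ be a metric space. A domain is a nonempty connected open set; $V\Subset U$ means that $\overline V$ is compact and contained in $U$. Measures are positive Borel measures (completed when integrable functions are considered). A harmonic measure on a domain $U$ with $\partial U\ne\varnothing$ is a family $\{\omega_x^U:x\in U\}$ of measures on $\partial U$ with $\omega_x^U(\partial U)=1$ and $\omega_x^U\ll\omega_y^U$ for all $x,y\in U$; write $\omega_x^U(f)=\int_{\partial U}f\,d\omega_x^U$. It is continuous if $x\mapsto\omega_x^U(f)$ is continuous on $U$ for every $f\in\bigcap_{x\in U}L^1(\partial U,\omega_x^U)$, and Radon if every $\omega_x^U$ is Radon. The domain $U$ is regular if for every $\zeta\in\partial U$ and every bounded Borel $f$ on $\partial U$ continuous at $\zeta$ one has $\omega_x^U(f)\to f(\zeta)$ as $U\ni x\to\zeta$. Standing framework: $\mathcal D$ is a family of domains of $X$, each with nonempty boundary and equipped with a continuous Radon harmonic measure, such that (i) every $U\in\mathcal D$ is the union of an increasing sequence of regular domains of $\mathcal D$ whose closures are compact and contained in $U$; (ii) for $V\Subset U$ in $\mathcal D$ with $V$ regular, $\omega_x^U(f)=\int_{\partial V}\omega_y^U(f)\,d\omega_x^V(y)$ for all $x\in V$ and all bounded Borel $f$ on $\partial U$. $D\subseteq X$ is a domain and $x_0\in D$ is fixed. A function $u:W\to\mathbb R$ on an open set $W$ is harmonic if it is continuous and $u(x)=\int_{\partial V}u\,d\omega_x^V$ for every regular $V\in\mathcal D$ with $V\Subset W$ and every $x\in V$. $\mathcal H_1(D)$ is the set of strictly positive harmonic functions $h$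 on $D$ with $h(x_0)=1$, with the topology of locally uniform convergence, and $\mathcal E(D)$ is its set of extreme points (equivalently, the functions $h\in\mathcal H_1(D)$ that are minimal: every harmonic $v$ with $0\le v\le h$ equals $ch$ for some $c\in[0,1]$), with the inherited Borel structure. For regular $U\in\mathcal D$ with $U\Subset D$, $x_0\in U$, the relative kernel is $K_U(x,y)=\frac{d\omega_x^U}{d\omega_{x_0}^U}(y)$, $x\in U$, $y\in\partial U$. A compactification of $D$ is a compact Hausdorff space containing $D$ (with its topology) as a dense subspace. For compact metrizable compactifications $D^G,D^K$ of $D$, the common refinement is $D^G\vee D^K=\overline{\{(x,x):x\in D\}}\subseteq D^G\times D^K$, with $D$ identified with its diagonal image, and $p_K$ is the restriction of the second coordinate projection. On a compact space $Y$, $\mu_n\Longrightarrow\mu$ means $\int f\,d\mu_n\to\int f\,d\mu$ for every $f\in C(Y)$; $p_\#\mu(A)=\mu(p^{-1}(A))$. A measure is carried by a Borel set if the complement has measure zero; measures carried by a Borel subset of a space are identified with their extensions by zero. Under the stated hypotheses each weak limit $\widehat\mu_u$ is carried by $\widehat\partial_{\mathrm m}D$. *)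

(* Defs.v *)
From HB Require Import structures.
From mathcomp Require Import all_boot all_order all_algebra.
From mathcomp Require Import all_classical all_reals all_analysis.

Set Implicit Arguments.
Unset Strict Implicit.
Unset Printing Implicit Defensive.

Import Order.TTheory GRing.Theory Num.Theory.
Import numFieldNormedType.Exports.

Local Open Scope classical_set_scope.
Local Open Scope ring_scope.

(* Measurable types of the library are pointed, so a metric space carrying
   measures is a metric space with a distinguished point (which is never used);
   every space considered below is nonempty. *)
#[short(type="pmetricType")]
HB.structure Definition PMetric (R : numDomainType) :=
  {T of Pointed T & Metric R T}.

HB.instance Definition _ (S T : ptopologicalType) := Pointed.on (S * T)%type.

Definition borel (T : ptopologicalType) := g_sigma_algebraType (@open T).

Section measures.
Context {R : realType} {T : ptopologicalType}.
Implicit Type mu : set (borel T) -> \bar R.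

(* Compact subsets of the Hausdorff spaces used below are Borel. *)
Definition radon mu : Prop :=
  (forall x : T, exists N : set T, [/\ open N, N x & (mu N < +oo)%E]) /\
  (forall A : set (borel T), measurable A ->
     mu A = ereal_sup [set mu C | C in [set C : set T | compact C /\ C `<=` A]]).

Definition carried mu (S : set (borel T)) : Prop := mu (~` S) = 0%E.

(* Weak convergence of measures on a compact subspace [Y] of [T]; measures on
   [Y] are identified with their extensions by zero to [T]. *)
Definition weak_cvg (Y : set (borel T)) (mu_ : nat -> set (borel T) -> \bar R) mu
    : Prop :=
  forall f : T -> R, {within (Y : set T), continuous f} ->
    (\int[mu_ n]_(y in Y) (f y)%:E @[n --> \oo] -->
     \int[mu]_(y in Y) (f y)%:E)%E.

Definition weak_limit (Y : set (borel T)) (mu_ : nat -> set (borel T) -> \bar R)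
    mu : Prop :=
  exists2 phi : nat -> nat, {homo phi : m n / (m < n)%N} &
    weak_cvg Y (mu_ \o phi) mu.

(* The measure [f dmu] on [A], extended by zero; it is a measure when [f] is
   nonnegative and measurable on [A]. *)
Definition density_on mu (A : set (borel T)) (f : T -> R) :
    set (borel T) -> \bar R :=
  fun B => (\int[mu]_(x in A `&` B) (f x)%:E)%E.

End measures.

Section topology.
Context {X : topologicalType}.
Implicit Types U V : set X.

Definition bd U : set X := closure U `\` U°.

Definition domain U : Prop := [/\ U !=set0, connected U & open U].

Definition relcompact V U : Prop := compact (closure V) /\ closure V `<=` U.

(* [f_ n] is only meaningful on [D_ n]. *)
Definition loc_unif_cvg {R : realType} (D : set X) (D_ : nat -> set X)
    (f_ : nat -> X -> R) (f : X -> R) : Prop :=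
  forall x, D x -> exists2 N : set X, nbhs x N &
    forall e : R, 0 < e -> \forall n \near \oo,
      forall z, N z -> D_ n z /\ `|f_ n z - f z| < e.

(* [i] embeds the subspace [D] as a dense subspace of the compact space [K];
   values of [i] outside [D] are irrelevant. *)
Definition compactification (K : topologicalType) (D : set X) (i : X -> K)
    : Prop :=
  [/\ compact [set: K], hausdorff_space K, dense (i @` D), set_inj D i &
      forall A : set X, (exists2 O, open O & D `&` O = A) <->
                        (exists2 O, open O & D `&` i @^-1` O = A)].

Definition diag {G K : Type} (i : X -> G) (j : X -> K) (x : X) : G * K :=
  (i x, j x).

Definition refinement {G K : topologicalType} (D : set X) (i : X -> G)
    (j : X -> K) : set (G * K) :=
  closure (diag i j @` D).

End topology.

Definition extreme_points {R : realType} {V : lmodType R} (C : set V) : set V :=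
  [set h | C h /\ forall h1 h2 (t : R), C h1 -> C h2 -> 0 < t < 1 ->
     h = t *: h1 + (1 - t) *: h2 -> h1 = h /\ h2 = h].

Section potential_theory.
Context {R : realType} {X : pmetricType R}.
Implicit Types (U V W D : set X) (w : X -> probability (borel X) R).

(* The measures [w x], [x] in [U], are probabilities on [X] concentrated on the
   boundary of [U]; [w x] is irrelevant for [x] outside [U]. *)
Definition harmonic_measure U w : Prop :=
  [/\ bd U !=set0,
      forall x, U x -> w x (bd U) = 1%E &
      forall x y, U x -> U y -> w x `<< w y].

(* Every function in the L^1 spaces of the completed measures (which all have
   the same null sets) has a Borel representative. *)
Definition continuous_harmonic_measure U w : Prop :=
  forall f : X -> R,
    (forall x, U x -> (w x).-integrable (bd U) (EFin \o f)) ->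
    {within U, continuous (fun x => \int[w x]_(y in bd U) f y)}.

Definition radon_harmonic_measure U w : Prop := forall x, U x -> radon (w x).

Definition bounded_borel_on (A : set (borel X)) (f : X -> R) : Prop :=
  measurable_fun A (f : borel X -> R) /\
  exists M : R, forall y, A y -> `|f y| <= M.

Definition regular U w : Prop :=
  forall (zeta : X) (f : X -> R), bd U zeta -> bounded_borel_on (bd U) f ->
    f y @[y --> within (bd U) (nbhs zeta)] --> f zeta ->
    \int[w x]_(y in bd U) f y @[x --> within U (nbhs zeta)] --> f zeta.

Variables (calD : set (set X)) (omega : set X -> X -> probability (borel X) R).

Definition framework : Prop :=
  [/\ forall U, calD U ->
        [/\ domain U, harmonic_measure U (omega U),
            continuous_harmonic_measure U (omega U) &
            radon_harmonic_measure U (omega U)],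
      forall U, calD U -> exists V_ : nat -> set X,
        [/\ forall n, [/\ calD (V_ n), regular (V_ n) (omega (V_ n)) &
                          relcompact (V_ n) U],
            forall n, V_ n `<=` V_ n.+1 &
            U = \bigcup_n V_ n] &
      forall U V, calD U -> calD V -> relcompact V U ->
        regular V (omega V) ->
        forall (x : X) (f : X -> R), V x -> bounded_borel_on (bd U) f ->
          \int[omega U x]_(z in bd U) f z =
          \int[omega V x]_(y in bd V) \int[omega U y]_(z in bd U) f z].

Definition harmonic_on W (u : X -> R) : Prop :=
  {within W, continuous u} /\
  forall V, calD V -> regular V (omega V) -> relcompact V W ->
    forall x, V x -> u x = \int[omega V x]_(y in bd V) u y.

(* Functions on [D] are represented by their extensions by zero, so that
   equality in [H1] and [extremal_harmonic] is equality of functions on [D]. *)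
Definition H1 D (x0 : X) : set (X -> R) :=
  [set h | [/\ harmonic_on D h, forall x, D x -> 0 < h x, h x0 = 1 &
               forall x, ~ D x -> h x = 0]].

Definition extremal_harmonic D (x0 : X) : set (X -> R) :=
  extreme_points (H1 D x0).

(* The topology of [compact_conv D] is that of uniform convergence on the compact
   subsets of [D]; this is locally uniform convergence on [D] as soon as [D] is
   locally compact, in particular when [D] is exhausted by relatively compact
   open sets. *)
Definition compact_conv D : Type :=
  {family [set A : set X | compact A /\ A `<=` D], X -> R}.

HB.instance Definition _ D := Uniform.on (compact_conv D).
HB.instance Definition _ D := isPointed.Build (compact_conv D) (fun=> 0).

Definition continuous_kernel U (x0 : X) (k : X -> X -> R) : Prop :=
  {within U `*` bd U, continuous (fun z : X * X => k z.1 z.2)} /\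
  forall x, U x -> {ae omega U x0, forall y, bd U y ->
    (k x y)%:E = Radon_Nikodym (charge_of_finite_measure (omega U x)) (omega U x0) y}.

End potential_theory.

(* Main.v *)
Require Import Defs.
From HB Require Import structures.
From mathcomp Require Import all_boot all_order all_algebra.
From mathcomp Require Import all_classical all_reals all_analysis.
From mathcomp Require Import measurable_realfun.
From mathcomp Require Import lra.

(** The theorem holds because every positive harmonic function [u] on [D] is a
mixture of minimal ones, and because the measure of a mixture can be read off
from the measures [u * omega (D_ n) x0].

Existence of a mixture.  Harmonicity on [E n] reads
[h x = \int[omega (E n) x0]_(y in bd (E n)) (KE n x y * h y)], and the kernel
[KE n] is continuous up to the boundary.  Hence the nonnegative harmonic functions
with [h x0 <= 1] are locally bounded and equicontinuous ([harnack_bound],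
[harnack_equicont]).  As the harmonic measures from different points have the same
null sets, such a function that vanishes at one point vanishes at [x0]
([harmonic_minimum]), so that [H1 D x0] is compact for pointwise convergence
([H1_compact]).  It is convex and its points are separated by countably many
evaluations, and Choquet's theorem ([choquet]) yields a probability [m] carried by
the extreme points with barycentre [u], once [u x0 = 1].

Transport to the boundary.  The set [dmK] parametrises the extreme points through
[kappa], whose inverse has to be measurable for [m] to be moved to [dmK].  For a
continuous [phi] on [DK], the convergence of the measures
[kappa eta * omega (D_ n) x0] to the point mass at [eta] says that
[phi eta = lim_n \int[omega (D_ n) x0]_(y in bd (D_ n)) (kappa eta y * phi (iK y))],
and each term of this limit is a measurable function of [a = kappa eta]
([measurable_mixture_integral]).  So [phi] composed with the inverse of [kappa] is
a limit of measurable functions, which suffices in a metric space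
([H1_representation]).

Uniqueness and weak convergence.  Let [nu] be any finite measure on [dmK] that
represents [u].  Exchanging the integrals over [dmK] and over [bd (D_ n)] and then
using dominated convergence, with the bound [kappa eta x0 = 1], shows that
[\int[omega (D_ n) x0]_(y in bd (D_ n)) (u y * f (iK y))] tends to
[\int[nu]_(eta in dmK) f eta] for all continuous [f] ([representation_limit]).
The left-hand side does not depend on [nu], hence [nu] is unique
([representation_unique]); it is the weak limit on [DK] of the whole sequence, and
the image under the projection of every weak limit on the refinement.  A measure on
the refinement represents [u] if and only if its image does, so that all parts of
the theorem follow.

Proof of Choquet's theorem.  There is a continuous function [F] on the compact
convex set that is strictly convex along every coordinate ([strictly_convex_ex]).
Among the normalised positive functionals with barycentre [u], one maximises the
value at [F] ([max_functional]); it is integration against a measure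
([riesz_representation]).  If this measure charged the midpoints of the segments
that are long in some coordinate, moving the mass of such midpoints to the ends of
their segments would keep the barycentre and increase the value at [F]
([max_measure_midpoints]).  The points that are no such midpoint are extreme. *)

Import Order.TTheory GRing.Theory Num.Theory.
Import numFieldNormedType.Exports.

Set Implicit Arguments.
Unset Strict Implicit.
Unset Printing Implicit Defensive.

Local Open Scope classical_set_scope.
Local Open Scope ring_scope.

(** * Positive functionals and the measures representing them *)

Section positive_functionals.
Context {R : realType} {T : topologicalType} (C : set T).
Implicit Types (f g : T -> R) (L : (T -> R) -> R).

Definition cont_on : set (T -> R) := [set f | {within C, continuous f}].

Lemma cont_on_cst (c : R) : cont_on (fun=> c).
Proof. by move=> x; exact: cvg_cst. Qed.

Lemma cont_onD f g : cont_on f -> cont_on g -> cont_on (fun x => f x + g x).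
Proof. by move=> cf cg x; apply: cvgD; [exact: cf|exact: cg]. Qed.

Lemma cont_onM f g : cont_on f -> cont_on g -> cont_on (fun x => f x * g x).
Proof. by move=> cf cg x; apply: cvgM; [exact: cf|exact: cg]. Qed.

Lemma cont_onB f g : cont_on f -> cont_on g -> cont_on (fun x => f x - g x).
Proof. by move=> cf cg x; apply: cvgB; [exact: cf|exact: cg]. Qed.

Lemma cont_on_max f g :
  cont_on f -> cont_on g -> cont_on (fun x => Num.max (f x) (g x)).
Proof. by move=> cf cg x; apply: continuous_max; [exact: cf|exact: cg]. Qed.

Lemma cont_on_min f g :
  cont_on f -> cont_on g -> cont_on (fun x => Num.min (f x) (g x)).
Proof. by move=> cf cg x; apply: continuous_min; [exact: cf|exact: cg]. Qed.

Lemma cont_on_sum (F : nat -> T -> R) n : (forall k, cont_on (F k)) ->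
  cont_on (fun x => \sum_(k < n) F k x).
Proof.
move=> cF; elim: n => [|n IH].
  rewrite (_ : (fun _ => _) = fun=> 0); first exact: cont_on_cst.
  by apply/funext => x; rewrite big_ord0.
rewrite (_ : (fun _ => _) = fun x => \sum_(k < n) F k x + F n x).
  exact: cont_onD.
by apply/funext => x; rewrite big_ord_recr.
Qed.

Definition positive_functional L : Prop :=
  [/\ forall f g, cont_on f -> cont_on g ->
        L (fun x => f x + g x) = L f + L g,
      forall (c : R) f, cont_on f -> L (fun x => c * f x) = c * L f &
      forall f, cont_on f -> (forall x, C x -> 0 <= f x) -> 0 <= L f].

Variables (L : (T -> R) -> R) (hL : positive_functional L).

Lemma functionalD f g : cont_on f -> cont_on g ->
  L (fun x => f x + g x) = L f + L g.
Proof. by have [h _ _] := hL; exact: h. Qed.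

Lemma functionalZ (c : R) f : cont_on f -> L (fun x => c * f x) = c * L f.
Proof. by have [_ h _] := hL; exact: h. Qed.

Lemma functional_ge0 f :
  cont_on f -> (forall x, C x -> 0 <= f x) -> 0 <= L f.
Proof. by have [_ _ h] := hL; exact: h. Qed.

Lemma functional0 : L (fun=> 0) = 0.
Proof.
rewrite (_ : (fun=> 0) = fun x : T => 0 * (fun=> 0 : R) x :> R).
  by rewrite functionalZ ?mul0r//; exact: cont_on_cst.
by apply/funext => x; rewrite mul0r.
Qed.

Lemma functionalB f g : cont_on f -> cont_on g ->
  L (fun x => f x - g x) = L f - L g.
Proof.
move=> cf cg; rewrite -(mulN1r (L g)) -functionalZ// -functionalD//.
  by congr L; apply/funext => x; rewrite mulN1r.
by apply: cont_onM => //; exact: cont_on_cst.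
Qed.

Lemma functional_le f g : cont_on f -> cont_on g ->
  (forall x, C x -> f x <= g x) -> L f <= L g.
Proof.
move=> cf cg fg; rewrite -subr_ge0 -functionalB//.
apply: functional_ge0; first exact: cont_onB.
by move=> x Cx; rewrite subr_ge0 fg.
Qed.

Lemma functional_sum (F : nat -> T -> R) n : (forall k, cont_on (F k)) ->
  L (fun x => \sum_(k < n) F k x) = \sum_(k < n) L (F k).
Proof.
move=> cF; elim: n => [|n IH].
  rewrite big_ord0 -[RHS]functional0; congr L.
  by apply/funext => x; rewrite big_ord0.
rewrite big_ord_recr/= -IH -functionalD//; last exact: cont_on_sum.
by congr L; apply/funext => x; rewrite big_ord_recr.
Qed.

End positive_functionals.

Section nat_pairs.
Local Open Scope ereal_scope.
Context {R : realType}.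

(** The enumeration [f] comes before the family [a]: when countably many covers are
merged, the functions and the values of the functional at them have to be listed in
the same order. *)
Lemma nneseries_pair : exists f : nat -> nat * nat,
  forall a : nat -> nat -> \bar R, (forall i j, 0 <= a i j) ->
    \sum_(n <oo) a (f n).1 (f n).2 = \sum_(i <oo) \sum_(j <oo) a i j.
Proof.
have /card_esym/ppcard_eqP[f] := card_nat2.
exists f => a a0.
rewrite [RHS]nneseries_esumT; last by move=> n; exact: nneseries_ge0.
under [RHS]eq_esum do rewrite nneseries_esumT//.
rewrite (@esum_esum _ _ _ setT (fun=> setT))//.
rewrite nneseries_esumT// (reindex_esum setT _ f)//.
rewrite (_ : setT `*`` _ = setT); last by apply/seteqP; split.
exact: bij.
Qed.

End nat_pairs.

Section daniell_outer_measure.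
Context {R : realType} {T : ptopologicalType} (C : set T).
Variables (L : (T -> R) -> R) (hL : positive_functional C L).
Local Open Scope ereal_scope.

(** Nothing is asked outside [C], so that the complement of [C] will have outer
measure zero. *)
Definition fcover (A : set T) : set (nat -> T -> R) :=
  [set g | [/\ forall k, cont_on C (g k),
              forall k x, C x -> (0 <= g k x)%R &
              forall x, C x -> A x -> 1 <= \sum_(k <oo) (g k x)%:E]].

Definition daniell (A : set T) : \bar R :=
  ereal_inf [set \sum_(k <oo) (L (g k))%:E | g in fcover A].

Lemma fcover_ge0 A g k : fcover A g -> 0 <= (L (g k))%:E.
Proof. by move=> [cg g0 _]; rewrite lee_fin (functional_ge0 hL)// => x; exact: g0. Qed.

Lemma le_daniell A g : fcover A g -> daniell A <= \sum_(k <oo) (L (g k))%:E.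
Proof. by move=> gA; apply: ereal_inf_lbound; exists g. Qed.

Lemma le_daniell2 A (g : nat -> nat -> T -> R) :
  (forall i j, cont_on C (g i j)) ->
  (forall i j x, C x -> (0 <= g i j x)%R) ->
  (forall x, C x -> A x -> 1 <= \sum_(i <oo) \sum_(j <oo) (g i j x)%:E) ->
  daniell A <= \sum_(i <oo) \sum_(j <oo) (L (g i j))%:E.
Proof.
move=> cg g0 gA; have [f fE] := @nneseries_pair R.
rewrite -(fE (fun i j => (L (g i j))%:E)); last first.
  by move=> i j; rewrite lee_fin (functional_ge0 hL)// => x; exact: g0.
apply: (@le_daniell A (fun n => g (f n).1 (f n).2)); split => //.
- by move=> k x; exact: g0.
- move=> x Cx Ax; rewrite (fE (fun i j => (g i j x)%:E)); first exact: gA.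
  by move=> i j; rewrite lee_fin g0.
Qed.

Lemma daniell_ge0 A : 0 <= daniell A.
Proof.
apply: le_ereal_inf_tmp => _ [g gA <-].
by apply: nneseries_ge0 => k _ _; exact: (fcover_ge0 _ gA).
Qed.

Lemma daniell_le_one (A : set T) (g : T -> R) : cont_on C g ->
  (forall x, C x -> (0 <= g x)%R) ->
  (forall x, C x -> A x -> (1 <= g x)%R) -> daniell A <= (L g)%:E.
Proof.
move=> cg g0 gA.
have E (u : nat -> \bar R) a : u 0%N = a -> (forall n, u n.+1 = 0) ->
    (forall n, 0 <= u n) -> \sum_(k <oo) u k = a.
  move=> u0 uS uge; rewrite nneseries_recl// u0 eseries0 ?adde0//.
  by case=> //= n _ _; exact: uS.
pose G (k : nat) : T -> R := if k is 0%N then g else fun=> 0%R.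
apply: le_trans (le_daniell (g := G) _) _.
- split.
  + by case => //= k; exact: cont_on_cst.
  + by case => [|k] x Cx /=; [exact: g0|].
  + move=> x Cx Ax; rewrite (E _ (g x)%:E)//; first by rewrite lee_fin gA.
    by case=> //=; rewrite lee_fin g0.
- rewrite (E _ (L g)%:E)//.
  + by move=> n /=; rewrite (functional0 hL).
  + move=> [|n] /=; last by rewrite (functional0 hL).
    by rewrite lee_fin (functional_ge0 hL).
Qed.

Lemma daniell0 : daniell set0 = 0.
Proof.
apply/eqP; rewrite eq_le daniell_ge0 andbT.
rewrite -[leRHS]/(0%R)%:E -(functional0 hL); apply: daniell_le_one => //.
exact: cont_on_cst.
Qed.

Lemma daniellS : {homo daniell : A B / A `<=` B >-> A <= B}.
Proof.
move=> A B AB; apply/ereal_inf_le_tmp => _ [g [cg g0 gB] <-].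
by exists g => //; split => // x Cx /AB; exact: gB.
Qed.

Lemma daniell_fin A : daniell A \is a fin_num.
Proof.
rewrite ge0_fin_numE ?daniell_ge0//; apply: le_lt_trans (ltry (L (fun=> 1%R))).
by apply: daniell_le_one => //; exact: cont_on_cst.
Qed.

Lemma daniell_sigma_subadditive : sigma_subadditive daniell.
Proof.
move=> A; suff add2e (e : {posnum R}) :
    daniell (\bigcup_n A n) <= \sum_(i <oo) daniell (A i) + e%:num%:E.
  by apply/lee_addgt0Pr => _/posnumP[].
rewrite (le_trans _ (epsilon_trick _ _ _))//; last first.
  by move=> n; exact: daniell_ge0.
pose P n (g : nat -> T -> R) := fcover (A n) g /\
  \sum_(k <oo) (L (g k))%:E <= daniell (A n) + (e%:num / (2 ^ n.+1)%:R)%:E.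
have [G PG] : {G : nat -> nat -> T -> R & forall n, P n (G n)}.
  apply: (@choice _ _ P) => n.
  have en1 : (0 < e%:num / (2 ^ n.+1)%:R)%R by [].
  have [_ [g gA <-] gle] := lb_ereal_inf_adherent en1 (daniell_fin (A n)).
  by exists g; split => //; exact: ltW.
apply: (@le_trans _ _ (\sum_(i <oo) \sum_(j <oo) (L (G i j))%:E)).
  apply: le_daniell2.
  - by move=> i j; case: (PG i) => -[].
  - by move=> i j x Cx; case: (PG i) => -[_ h _] _; exact: h.
  - have G0 i j x : C x -> 0 <= (G i j x)%:E.
      by move=> Cx; case: (PG i) => -[_ h _] _; rewrite lee_fin h.
    move=> x Cx [n _ An]; have [[_ _ /(_ x Cx An) h] _] := PG n.
    apply: le_trans h _.
    have S0 i : 0 <= \sum_(j <oo) (G i j x)%:E.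
      by apply: nneseries_ge0 => *; exact: G0.
    rewrite (@nneseriesD1 _ (fun i => \sum_(j <oo) (G i j x)%:E) n)//.
    by rewrite leeDl//; apply: nneseries_ge0.
apply: lee_nneseries => [i _ _|i _]; last exact: (PG i).2.
by apply: nneseries_ge0 => j _ _; exact: (fcover_ge0 _ (PG i).1).
Qed.

HB.instance Definition _ := isOuterMeasure.Build R T daniell
  daniell0 daniell_ge0 daniellS daniell_sigma_subadditive.

(** Write [U] for the set in question and let [h j] increase to its indicator.  If
the functions [f k] cover [X], the increments [f k * (h j.+1 - h j)] cover [X]
inside [U], and the remainder [f k * (1 - h J)] covers [X] outside [U].  For every
[J] the increments below [J] and the remainder add up to [f k], so the total cost
never exceeds that of the [f k]. *)
Lemma cozero_caratheodory (g : T -> R) : cont_on C g ->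
  daniell.-caratheodory [set x | (0 < g x)%R].
Proof.
move=> cg; apply: le_caratheodory_measurable => X; set U := [set x | _].
apply: le_ereal_inf_tmp => _ [f [cf f0 fX] <-].
pose h (j : nat) x : R := Num.min 1%R (Num.max 0%R (j%:R * g x)%R).
have ch j : cont_on C (h j).
  apply: cont_on_min; first exact: cont_on_cst.
  apply: cont_on_max; first exact: cont_on_cst.
  by apply: cont_onM => //; exact: cont_on_cst.
have h_le1 j x : (h j x <= 1)%R by rewrite /h ge_min lexx.
have h_inc j x : (h j x <= h j.+1 x)%R.
  rewrite /h le_min ge_min lexx /= ge_min; apply/orP; right.
  rewrite ge_max le_max lexx/=; have [g0|g0] := leP 0%R (g x).
    by rewrite le_max; apply/orP; right; rewrite ler_wpM2r// ler_nat.
  by rewrite le_max; apply/orP; left; rewrite mulr_ge0_le0// ltW.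
have h0 x : h 0%N x = 0%R by rewrite /h mul0r maxxx min_r.
pose phi k j x : R := (f k x * (h j.+1 x - h j x))%R.
have cphi k j : cont_on C (phi k j) by apply: cont_onM => //; exact: cont_onB.
have phi0 k j x : C x -> (0 <= phi k j x)%R.
  by move=> Cx; rewrite mulr_ge0 ?subr_ge0 ?f0.
have Lphi0 k j : 0 <= (L (phi k j))%:E.
  by rewrite lee_fin (functional_ge0 hL)// => x; exact: phi0.
have sphi k J x : (\sum_(j < J) phi k j x = f k x * h J x)%R.
  elim: J => [|J IH]; first by rewrite big_ord0 h0 mulr0.
  by rewrite big_ord_recr/= IH /phi -mulrDr addrC subrK.
have XU : daniell (X `&` U) <= \sum_(k <oo) \sum_(j <oo) (L (phi k j))%:E.
  apply: le_daniell2 => // x Cx [Xx Ux]; apply: le_trans (fX x Cx Xx) _.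
  apply: lee_nneseries => [k _ _|k _]; first by rewrite lee_fin f0.
  have gx : (0 < g x)%R by [].
  have [J gJ] : exists J : nat, (1 <= J%:R * g x)%R.
    exists (Num.truncn (g x)^-1).+1; rewrite -ler_pdivrMr// div1r.
    by rewrite ltW// truncnS_gt.
  have hJ : h J x = 1%R.
    by rewrite /h; apply/min_idPl; rewrite le_max gJ orbT.
  rewrite (_ : f k x = \sum_(j < J) phi k j x)%R; last by rewrite sphi hJ mulr1.
  rewrite -sumEFin -(big_mkord xpredT (fun j => (phi k j x)%:E)).
  by apply: nneseries_lim_ge => j _ _; rewrite lee_fin phi0.
have XUc J : daniell (X `&` ~` U) <=
    \sum_(k <oo) (L (fun x => f k x * (1 - h J x))%R)%:E.
  have c1 k : cont_on C (fun x => f k x * (1 - h J x))%R.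
    by apply: cont_onM => //; apply: cont_onB => //; exact: cont_on_cst.
  apply: (le_daniell (g := fun k x => f k x * (1 - h J x))%R); split => //.
    by move=> k x Cx; rewrite mulr_ge0 ?subr_ge0 ?f0.
  move=> x Cx [Xx /negP]; rewrite -leNgt => gx.
  apply: le_trans (fX x Cx Xx) _.
  have hJ : h J x = 0%R.
    rewrite /h (_ : Num.max _ _ = 0)%R; first by rewrite min_r.
    by apply/max_idPl; rewrite mulr_ge0_le0.
  apply: lee_nneseries => [k _ _|k _]; first by rewrite lee_fin f0.
  by rewrite hJ subr0 mulr1.
apply: le_trans (leeD XU (lexx _)) _.
rewrite nneseries_interchange//.
rewrite -leeBrDr ?(daniell_fin)//.
apply: lime_le; first by apply: is_cvg_nneseries => j _ _; exact: nneseries_ge0.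
apply: nearW => J; rewrite leeBrDr ?(daniell_fin)//.
apply: le_trans (leeD (lexx _) (XUc J)) _.
rewrite -nneseries_sum// -nneseriesD; last 2 first.
- by move=> k _ _; exact: sume_ge0.
- move=> k _ _; rewrite lee_fin (functional_ge0 hL)//.
    by apply: cont_onM => //; apply: cont_onB => //; exact: cont_on_cst.
  by move=> x Cx; rewrite mulr_ge0 ?subr_ge0 ?f0.
rewrite le_eqVlt; apply/orP; left; apply/eqP; apply: eq_eseriesr => k _.
rewrite big_mkord sumEFin -(functional_sum hL)// -EFinD -(functionalD hL)//.
- congr (L _)%:E; apply/funext => x.
  by rewrite sphi -mulrDr addrC subrK mulr1.
- exact: cont_on_sum.
- by apply: cont_onM => //; apply: cont_onB => //; exact: cont_on_cst.
Qed.

Hypothesis cC : compact C.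

(** This is where compactness enters: as in Dini's theorem, if the increasing partial
sums of a cover exceed [1 - e] pointwise in the limit, finitely many terms already
exceed it everywhere on [C], and then positivity of [L] bounds their cost. *)
Lemma daniellT : daniell setT = (L (fun=> 1%R))%:E.
Proof.
have c1 : cont_on C (fun=> 1%R : R) := @cont_on_cst _ _ C 1%R.
apply/eqP; rewrite eq_le daniell_le_one//=.
apply: le_ereal_inf_tmp => _ [g [cg g0 gT] <-].
have Lg0 k : 0 <= (L (g k))%:E.
  by rewrite lee_fin (functional_ge0 hL)// => x; exact: g0.
suff H (e : R) : (0 < e)%R ->
    ((1 - e) * L (fun=> 1%R))%:E <= \sum_(k <oo) (L (g k))%:E.
  rewrite leNgt; apply/negP.
  move=> Slt; have S0 := @nneseries_ge0 R _ xpredT 0%N (fun k _ _ => Lg0 k).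
  have [t St] : exists t : R, \sum_(k <oo) (L (g k))%:E = t%:E.
    exists (fine (\sum_(k <oo) (L (g k))%:E)); rewrite fineK//.
    by rewrite ge0_fin_numE// (lt_trans Slt)// ltry.
  rewrite {}St in S0 Slt H; rewrite lee_fin in S0; rewrite lte_fin in Slt.
  set l := L _ in Slt H.
  have l0 : (0 < l)%R by apply: le_lt_trans Slt.
  have := H ((l - t) / (2 * l))%R; rewrite divr_gt0 ?subr_gt0 ?mulr_gt0// => /(_ isT).
  rewrite lee_fin mulrBl mul1r -mulrA (_ : (2 * l)^-1 * l = 2^-1)%R.
    by move=> ?; lra.
  by rewrite invfM -mulrA mulVf ?mulr1// gt_eqF.
move=> e0.
have [N hN] : exists N : nat, forall x, C x -> (1 - e <= \sum_(k < N) g k x)%R.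
  have /compact_near_coveringP/near_covering_withinP := cC.
  move=> /(_ nat \oo (fun N x => 1 - e <= \sum_(k < N) g k x)%R _) [].
  - move=> x Cx.
    have [N hN] : exists N : nat, (1 - e < \sum_(k < N) g k x)%R.
      apply: contrapT => /forallNP h.
      have : \sum_(k <oo) (g k x)%:E <= (1 - e)%:E.
        apply: lime_le; first by apply: is_cvg_nneseries => k _ _; rewrite lee_fin g0.
        apply: nearW => n; rewrite big_mkord sumEFin lee_fin leNgt.
        by apply/negP; exact: h.
      move=> /(le_trans (gT x Cx I)); rewrite lee_fin => ?; lra.
    have cx : \forall x' \near within C (nbhs x), (1 - e < \sum_(k < N) g k x')%R.
      have /subspace_continuousP/(_ x Cx) :=
        @cont_on_sum _ _ C g N cg.
      by move=> /cvgr_gt; exact.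
    exists ([set x' | C x' -> (1 - e < \sum_(k < N) g k x')%R], [set n | (N <= n)%N]).
      by split => //=; exists N.
    move=> [x' n] /= [h Nn] Cx'; rewrite (le_trans (ltW (h Cx')))//.
    rewrite -(subnKC Nn) big_split_ord/= lerDl sumr_ge0// => i _; exact: g0.
  - by move=> N _ H; exists N => x Cx; exact: (H N (leqnn N) x Cx).
apply: (@le_trans _ _ (\sum_(0 <= k < N) (L (g k))%:E)).
  rewrite big_mkord sumEFin lee_fin -(functional_sum hL)// -(functionalZ hL)//.
  apply: (functional_le hL) => //; first exact/cont_onM/c1/cont_on_cst.
    exact: cont_on_sum.
  by move=> x Cx; rewrite mulr1 hN.
exact: nneseries_lim_ge.
Qed.

Definition cozero : set (set T) :=
  [set A | exists2 g : T -> R, cont_on C g & A = [set x | (0 < g x)%R]].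

(** The outer measure is additive on the sets where a continuous function is
positive, which need not generate the Borel sets of [C] unless [C] is metrizable. *)
Definition baire := g_sigma_algebraType cozero.

Lemma measurable_cozero (g : T -> R) : cont_on C g ->
  measurable ([set x | (0 < g x)%R] : set baire).
Proof. by move=> cg; apply: sub_sigma_algebra; exists g. Qed.

(** The indicator of the complement of [C] is continuous on [C], where it is zero. *)
Lemma measurable_baire : measurable (C : set baire).
Proof.
rewrite -(setCK C); apply: measurableC.
rewrite (_ : ~` C = [set x | (0 < \1_(~` C) x :> R)%R]).
  apply: measurable_cozero; apply/subspace_continuousP => x Cx.
  apply: cvg_near_cst; apply: filterS (withinT C _) => y Cy.
  by rewrite /from_subspace/= !indicE !memNset.
apply/seteqP; split => x /=; first by move=> Cx; rewrite indicE mem_set.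
rewrite indicE.
by have [/set_mem|] := boolP (x \in ~` C); rewrite ?ltxx.
Qed.

Lemma measurable_cont_on (g : T -> R) : cont_on C g ->
  measurable_fun [set: baire] (g : baire -> R).
Proof.
move=> cg; apply: (measurability _ (RGenOInfty.measurableE R)) => //.
move=> _ [_ [a ->] <-]; rewrite setTI.
rewrite (_ : _ @^-1` _ = [set x | (0 < g x - a)%R]).
  by apply: measurable_cozero; apply: cont_onB => //; exact: cont_on_cst.
by apply/seteqP; split => x /=; rewrite in_itv/= andbT subr_gt0.
Qed.

Lemma baire_caratheodory (A : set baire) : measurable A ->
  daniell.-caratheodory A.
Proof.
apply: smallest_sub.
  exact: (@sigma_algebra_measurable _ (caratheodory_type daniell)).
by move=> _ [g cg ->]; exact: cozero_caratheodory.
Qed.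

(** A second name, because [daniell] already carries the structure of an outer
measure. *)
Definition riesz_measure : set baire -> \bar R := daniell.

Let riesz_measure_additive : semi_sigma_additive riesz_measure.
Proof.
move=> F mF tF mUF.
apply: (@caratheodory_measure_sigma_additive _ _ daniell) => //.
  by move=> n; apply: baire_caratheodory; exact: mF.
exact: baire_caratheodory.
Qed.

HB.instance Definition _ := isMeasure.Build _ _ _ riesz_measure
  daniell0 daniell_ge0 riesz_measure_additive.

Let riesz_measure_fin : fin_num_fun riesz_measure.
Proof. by move=> A _; exact: daniell_fin. Qed.

HB.instance Definition _ := Measure_isFinite.Build _ _ _ riesz_measure
  riesz_measure_fin.

Lemma riesz_measure_compl : riesz_measure (~` C) = 0.
Proof.
apply/eqP; rewrite eq_le daniell_ge0 andbT.
rewrite -[leRHS]/(0%R)%:E -(functional0 hL); apply: daniell_le_one => //.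
exact: cont_on_cst.
Qed.

Lemma riesz_measureC : riesz_measure C = (L (fun=> 1%R))%:E.
Proof.
rewrite -daniellT -/(riesz_measure setT) -(setUv C).
rewrite measureU//; last by rewrite setICr.
- by rewrite [X in _ + X](_ : _ = 0) ?adde0// -riesz_measure_compl.
- exact: measurable_baire.
- by apply: measurableC; exact: measurable_baire.
Qed.

(** Cut [f] into layers [h i] of height [d].  Layer [i.+1] is at most [d] and lives
where layer [i] is full, so its integral is at most [d] times the outer measure of
a set covered by [h i / d], that is, at most [L (h i)].  Only the first layer, of
size [d], is lost. *)
Lemma riesz_le (f : T -> R) (M : R) : cont_on C f -> (0 < M)%R ->
  (forall x, C x -> (0 <= f x <= M)%R) ->
  \int[riesz_measure]_(x in C) (f x)%:E <= (L f)%:E.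
Proof.
move=> cf M0 fM.
have c1 : cont_on C (fun=> 1%R : R) := @cont_on_cst _ _ C 1%R.
have L1 : (0 <= L (fun=> 1%R))%R by apply: (functional_ge0 hL).
suff H (N : nat) : \int[riesz_measure]_(x in C) (f x)%:E <=
    (M / N.+1%:R * L (fun=> 1%R) + L f)%:E.
  apply/lee_addgt0Pr => e e0.
  pose N := Num.truncn (e^-1 * (M * L (fun=> 1%R))).
  apply: le_trans (H N) _; rewrite -EFinD lee_fin addrC lerD2l.
  by rewrite mulrAC ler_pdivrMr// -ler_pdivrMl// ltW// truncnS_gt.
set d := (M / N.+1%:R)%R; have d0 : (0 < d)%R by rewrite divr_gt0.
pose h (i : nat) x : R := Num.min d (Num.max 0 (f x - d *+ i))%R.
have h0 i x : (0 <= h i x)%R by rewrite /h le_min le_max lexx ltW.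
have ch i : cont_on C (h i).
  apply: cont_on_min; first exact: cont_on_cst.
  apply: cont_on_max; first exact: cont_on_cst.
  by apply: cont_onB => //; exact: cont_on_cst.
have hsum n x : C x -> (\sum_(i < n) h i x = Num.min (f x) (d *+ n))%R.
  move=> Cx; have /andP[f0 _] := fM x Cx.
  elim: n => [|n IH]; first by rewrite big_ord0 mulr0n min_r.
  rewrite big_ord_recr/= IH /h mulrSr.
  have dn : (0 <= d *+ n)%R by rewrite mulrn_wge0// ltW.
  rewrite /Num.max /Num.min; case: ifPn; case: ifPn; case: ifPn; case: ifPn; lra.
have hf x : C x -> (f x = \sum_(i < N.+1) h i x)%R.
  move=> Cx; rewrite hsum//; have /andP[_ fxM] := fM x Cx.
  by rewrite min_l// /d -mulr_natr divfK.
rewrite (eq_integral (fun x : baire => \sum_(i < N.+1) (h i x)%:E)); last first.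
  by move=> x /[!inE] Cx; rewrite hf// sumEFin.
have mC := measurable_baire.
have mh i : measurable_fun (C : set baire) (h i : baire -> R).
  by apply: measurable_funTS; exact: measurable_cont_on.
rewrite ge0_integral_sum//=; last 2 first.
- by move=> i; exact/measurable_EFinP.
- by move=> i x Cx; rewrite lee_fin.
rewrite big_ord_recl/= EFinD leeD//.
  rewrite EFinM -riesz_measureC -integral_cst//; apply: ge0_le_integral => //=.
  - by move=> x _; rewrite lee_fin.
  - exact/measurable_EFinP.
  - by move=> x _; rewrite lee_fin /h ge_min lexx.
have Lf : (\sum_(i < N) L (h i) <= L f)%R.
  rewrite -(functional_sum hL)//; apply: (functional_le hL) => //.
    exact: cont_on_sum.
  by move=> x Cx; rewrite [leRHS]hf// big_ord_recr/= lerDl.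
rewrite (@le_trans _ _ (\sum_(i < N) (L (h i))%:E))//; last by rewrite sumEFin lee_fin.
apply: lee_sum => i _.
pose U := [set x | (0 < h (lift ord0 i) x)%R].
have mU : measurable (U : set baire) by exact: measurable_cozero.
apply: (@le_trans _ _ (d%:E * riesz_measure U)); last first.
  have -> : L (h i) = (d * L (fun x => d^-1 * h i x))%R.
    by rewrite (functionalZ hL)// mulVKf// gt_eqF.
  rewrite (EFinM d); apply: lee_wpmul2l; first by rewrite lee_fin ltW.
  apply: daniell_le_one; first by apply: cont_onM => //; exact: cont_on_cst.
    by move=> x Cx; rewrite mulr_ge0// invr_ge0 ltW.
  move=> x Cx; rewrite /U/= ler_pdivlMl// mulr1 /h /= => Ux.
  rewrite le_min lexx/= le_max; apply/orP; right.
  move: Ux; rewrite lt_min lt_max ltxx/= => /andP[_].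
  rewrite /bump/= add1n mulrSr; lra.
rewrite -integral_cst// [leLHS]integral_mkcond [leRHS]integral_mkcond.
apply: ge0_le_integral => //.
- by move=> x _; apply: erestrict_ge0 => y _; rewrite lee_fin.
- exact/(measurable_restrictT _ _).1/measurable_EFinP.
- by apply/(measurable_restrictT _ _).1 => //; exact: measurable_cst.
- move=> x _; rewrite !patchE; case: ifPn => Cx; last first.
    by case: ifPn => // _; rewrite lee_fin ltW.
  case: ifPn => [_|]; first by rewrite lee_fin /h ge_min lexx.
  by rewrite notin_setE => /negP; rewrite -leNgt lee_fin.
Qed.

Lemma cont_on_bounded (f : T -> R) : cont_on C f ->
  exists2 M : R, (0 < M)%R & forall x, C x -> (`|f x| <= M)%R.
Proof.
move=> cf; have /compact_bounded[M [Mr H]] := continuous_compact cf cC.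
exists (`|M| + 1)%R; first by rewrite ltr_wpDl.
move=> x Cx; apply: (H (`|M| + 1)%R); last by exists x.
by rewrite (le_lt_trans (ler_norm _))// ltrDl.
Qed.

Lemma integrable_cont_on (f : T -> R) : cont_on C f ->
  riesz_measure.-integrable C (EFin \o f : baire -> \bar R).
Proof.
move=> cf; have mC := measurable_baire.
apply: measurable_bounded_integrable => //.
- by rewrite -ge0_fin_numE// fin_num_measure.
- by apply: measurable_funTS; exact: measurable_cont_on.
- have [M M0 fM] := cont_on_bounded cf; exists M; split; first exact: num_real.
  by move=> N MN x Cx /=; rewrite (le_trans (fM _ Cx))// ltW.
Qed.

(** The one-sided bound [riesz_le], applied to [f + M] and to [M - f], gives the
equality. *)
Theorem riesz_integral (f : T -> R) : cont_on C f ->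
  \int[riesz_measure]_(x in C) (f x)%:E = (L f)%:E.
Proof.
move=> cf; have [M M0 fM] := cont_on_bounded cf.
have mC := measurable_baire.
have cM : cont_on C (fun=> M) by exact: cont_on_cst.
have LM : L (fun=> M) = (M * L (fun=> 1%R))%R.
  rewrite -(functionalZ hL); last exact: (@cont_on_cst _ _ C 1%R).
  by congr L; apply/funext => x; rewrite mulr1.
have intM : \int[riesz_measure]_(x in C) M%:E = (L (fun=> M))%:E.
  by rewrite integral_cst// LM EFinM; congr (_ * _); exact: riesz_measureC.
have intf := integrable_fin_num mC (integrable_cont_on cf).
have M2 : (0 < M + M)%R by rewrite addr_gt0.
have up : \int[riesz_measure]_(x in C) (f x + M)%:E <= (L f + L (fun=> M))%:E.
  rewrite -(functionalD hL)//; apply: (riesz_le _ M2); first exact: cont_onD.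
  by move=> x /fM; rewrite ler_norml => /andP[]; lra.
have dn : \int[riesz_measure]_(x in C) (M - f x)%:E <= (L (fun=> M) - L f)%:E.
  rewrite -(functionalB hL)//; apply: (riesz_le _ M2); first exact: cont_onB.
  by move=> x /fM; rewrite ler_norml => /andP[]; lra.
move: up dn; under eq_integral do rewrite EFinD.
rewrite (integralD mC (integrable_cont_on cf) (integrable_cont_on cM))/= intM.
under [X in _ -> X <= _ -> _]eq_integral do rewrite EFinB.
rewrite (integralB mC (integrable_cont_on cM) (integrable_cont_on cf))/= intM.
rewrite -(fineK intf) -EFinD -EFinB !lee_fin => up dn.
by congr EFin; apply/eqP; rewrite eq_le; apply/andP; split; lra.
Qed.

Theorem riesz_representation : exists m : {finite_measure set baire -> \bar R},
  [/\ m (~` C) = 0, m C = (L (fun=> 1%R))%:E &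
      forall f, cont_on C f -> m.-integrable C (EFin \o f : baire -> \bar R) /\
        \int[m]_(x in C) (f x)%:E = (L f)%:E].
Proof.
exists riesz_measure; split.
- exact: riesz_measure_compl.
- exact: riesz_measureC.
- by move=> f cf; split; [exact: integrable_cont_on|exact: riesz_integral].
Qed.

End daniell_outer_measure.
Arguments baire R {T} C.

(** * Finite quadrature and limits along ultrafilters *)

Section finite_cover.
Context {T : ptopologicalType}.

Lemma compact_cover_within (A : set T) (O : T -> set T) : compact A ->
  (forall c, A c -> within A (nbhs c) (O c)) ->
  exists cs : seq T, (forall c, c \in cs -> A c) /\
    forall a, A a -> exists2 c, c \in cs & O c a.
Proof.
rewrite (@compact_cover T) => cA nO.
pose V c := [set x | A x -> O c x]°.
have [] := cA _ A V.
- by move=> c _; exact: open_interior.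
- by move=> a Aa; exists a => //; exact: nO.
- move=> cs csA Acs; exists (finmap.enum_fset cs); split.
    by move=> c /csA /set_mem.
  move=> a Aa; have [c /= ccs /interior_subset/(_ Aa) Oa] := Acs a Aa.
  by exists c.
Qed.

End finite_cover.

Section real_integrable.
Context {d} {T : measurableType d} {R : realType}.
Variables (m : {measure set T -> \bar R}) (A : set T) (mA : measurable A).
Implicit Types f g : T -> R.

Lemma rintegrableD f g : m.-integrable A (EFin \o f) ->
  m.-integrable A (EFin \o g) -> m.-integrable A (EFin \o (fun x => f x + g x)).
Proof. by move=> intf intg; apply: eq_integrable (integrableD mA intf intg). Qed.

Lemma rintegrableB f g : m.-integrable A (EFin \o f) ->
  m.-integrable A (EFin \o g) -> m.-integrable A (EFin \o (fun x => f x - g x)).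
Proof. by move=> intf intg; apply: eq_integrable (integrableB mA intf intg). Qed.

Lemma rintegrableZ (c : R) f : m.-integrable A (EFin \o f) ->
  m.-integrable A (EFin \o (fun x => c * f x)).
Proof. by move=> intf; apply: eq_integrable (integrableZl mA c intf). Qed.

End real_integrable.

Section quadrature.
Context {d} {T : measurableType d} {R : realType}.
Variables (m : {finite_measure set T -> \bar R}) (O : T -> set T).
Hypothesis mO : forall c, measurable (O c).

(** The cover is made disjoint by treating its members one after the other; the
weight of a node is the integral of [f] over the part of [A] that it receives.  The
nodes and weights do not depend on [g]. *)
Lemma quadrature (f : T -> R) (cs : seq T) (A : set T) : measurable A ->
  (forall a, A a -> exists2 c, c \in cs & O c a) ->
  m.-integrable A (EFin \o f) ->
  exists s : seq (R * T),
  [/\ forall p, p \in s -> p.2 \in cs,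
      (forall a, A a -> 0 <= f a) -> forall p, p \in s -> 0 <= p.1,
      \sum_(p <- s) p.1 = \int[m]_(x in A) f x &
      forall (g : T -> R) (e : R),
        m.-integrable A (fun x => (g x * f x)%:E) ->
        (forall c a, c \in cs -> A a -> O c a -> `|g a - g c| <= e) ->
        `|\int[m]_(x in A) (g x * f x) - \sum_(p <- s) p.1 * g p.2| <=
           e * \int[m]_(x in A) `|f x|].
Proof.
elim: cs A => [|c cs IH] A mA Acs intf.
  have A0 : A = set0.
    by apply/seteqP; split => // a /Acs [c]; rewrite inE.
  exists [::]; split => //; first by rewrite big_nil A0 Rintegral_set0.
  by move=> g e _ _; rewrite A0 !Rintegral_set0 big_nil subrr normr0 mulr0.
pose A1 := A `&` O c; pose A2 := A `\` O c.
have mA1 : measurable A1 by exact: measurableI.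
have mA2 : measurable A2 by exact: measurableD.
have AE : A = A1 `|` A2 by rewrite /A1 /A2 setUIDK.
have A12 : [disjoint A1 & A2].
  by apply/disj_set2P; apply/seteqP; split => // x [[_ ?] [_]].
have sA1 : A1 `<=` A by exact: subIsetl.
have sA2 : A2 `<=` A by exact: subDsetl.
have splitR (g : T -> R) : m.-integrable A (EFin \o g) ->
    \int[m]_(x in A) g x = \int[m]_(x in A1) g x + \int[m]_(x in A2) g x.
  by move=> ig; rewrite [in LHS]AE Rintegral_setU// -AE.
have int1 (g : T -> R) : m.-integrable A (EFin \o g) ->
    m.-integrable A1 (EFin \o g) by exact: integrableS.
have int2 (g : T -> R) : m.-integrable A (EFin \o g) ->
    m.-integrable A2 (EFin \o g) by exact: integrableS.
have [] := IH A2 mA2 _ (int2 _ intf).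
  move=> a [Aa nOa]; have [c'] := Acs a Aa.
  by rewrite inE => /predU1P[->//|c'cs] ?; exists c'.
move=> s [scs s0 ssum sg].
exists ((\int[m]_(x in A1) f x, c) :: s); split.
- by move=> p; rewrite !inE => /predU1P[-> /=|/scs ->]; rewrite ?eqxx ?orbT.
- move=> f0 p; rewrite inE => /predU1P[-> /=|].
    by apply: Rintegral_ge0 => x [/f0].
  by apply: s0 => a [/f0].
- by rewrite big_cons ssum -splitR.
- move=> g e intg ge; rewrite big_cons/= splitR//.
  have intf' := integrable_norm intf.
  rewrite [in leRHS]splitR// mulrDr opprD addrACA.
  rewrite (le_trans (ler_normD _ _))// lerD//; last first.
    apply: sg; first exact: int2.
    by move=> c' a c'cs [Aa _]; apply: ge => //; rewrite inE c'cs orbT.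
  have intcf := rintegrableZ mA (g c) intf.
  have -> : (\int[m]_(x in A1) f x) * g c = \int[m]_(x in A1) (g c * f x).
    by rewrite mulrC RintegralZl//; exact: int1.
  rewrite -RintegralB//; [|exact: int1|exact: int1].
  have intd := int1 _ (rintegrableB mA intg intcf).
  rewrite (le_trans (le_normr_Rintegral _ intd))// -RintegralZl//; last exact: int1.
  apply: le_Rintegral => //; first exact: (integrable_norm intd).
    exact/int1/rintegrableZ.
  by move=> x [Ax Ox]; rewrite -mulrBl normrM ler_wpM2r// ge// mem_head.
Qed.

End quadrature.

(** Pointed, so that spaces of functions can carry measures. *)
Definition ptwise (X : Type) (R : realType) : Type := {ptws X -> R}.
HB.instance Definition _ (X : Type) (R : realType) :=
  Topological.copy (ptwise X R) {ptws X -> R}.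
HB.instance Definition _ (X : Type) (R : realType) :=
  isPointed.Build (ptwise X R) (fun=> 0).

Lemma ptwise_cvgP {X : topologicalType} {R : realType}
    (F : set_system (ptwise X R)) (f : ptwise X R) : Filter F ->
  F --> f <-> forall t, (fun g : ptwise X R => g t) @ F --> (f t : R).
Proof. by move=> FF; exact: pointwise_cvgP. Qed.

Lemma ptwise_eval_continuous {X : topologicalType} {R : realType} (x : X) :
  continuous (fun g : ptwise X R => g x : R).
Proof. by move=> g; have /ptwise_cvgP := @cvg_id _ (nbhs g); exact. Qed.

Section ultralimit.
Context {R : realType}.

Lemma ultrafilter_oo : exists2 U : set_system nat, UltraFilter U & \oo `<=` U.
Proof. by have [U [UU ooU]] := @ultraFilterLemma nat \oo _; exists U. Qed.

Lemma ultra_fmap {I V : Type} (F : set_system I) (a : I -> V) :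
  UltraFilter F -> UltraFilter (a @ F).
Proof.
move=> FU; split; first exact: fmap_proper_filter.
move=> G GF aG; apply/seteqP; split; last exact: aG.
move=> A GA; have [//|nA] := in_ultra_setVsetC (a @^-1` A) FU.
by have /filter_ex[x []] : G (A `&` ~` A) by apply: filterI GA _; exact: aG.
Qed.

Lemma ultra_bounded_cvg {I : Type} (U : set_system I) (a : I -> R) (M : R) :
  UltraFilter U -> (\forall i \near U, `|a i| <= M) -> cvg (a i @[i --> U]).
Proof.
move=> UU aM; have := @segment_compact R (- M) M.
rewrite compact_ultra => /(_ (a @ U) (ultra_fmap a UU))[].
- by apply: (@filterS _ U _ _ _ _ aM) => i /=; rewrite in_itv/= -ler_norml.
- by move=> l [_ al]; apply/cvg_ex; exists l.
Qed.

End ultralimit.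

(** * Limits of functionals and a strictly convex function *)

Section functional_limits.
Context {R : realType} {T : ptopologicalType} (C : set T) (cC : compact C).
Implicit Type L : (T -> R) -> R.

Definition normalised L := positive_functional C L /\ L (fun=> 1) = 1.

Lemma normalised_bound L (g : T -> R) (M : R) : normalised L -> cont_on C g ->
  (forall x, C x -> `|g x| <= M) -> `|L g| <= M.
Proof.
move=> [hL L1] cg gM.
have LM : L (fun=> M) = M.
  rewrite -[RHS]mulr1 -L1 -(functionalZ hL); last exact: (@cont_on_cst _ _ C 1).
  by congr L; apply/funext => x; rewrite mulr1.
have cM : cont_on C (fun=> M) := @cont_on_cst _ _ C M.
rewrite ler_norml; apply/andP; split.
  rewrite -subr_ge0 opprK -[X in _ + X]LM -(functionalD hL)//.
  apply: (functional_ge0 hL); first exact: cont_onD.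
  by move=> x /gM; rewrite ler_norml => /andP[]; lra.
rewrite -[leRHS]LM; apply: (functional_le hL) => //.
by move=> x /gM; rewrite ler_norml => /andP[].
Qed.

(** Weak compactness of the normalised functionals: along an ultrafilter all the
bounded sequences [L n g] converge simultaneously. *)
Lemma normalised_cluster (U : set_system nat) (L : nat -> (T -> R) -> R) :
  UltraFilter U -> (forall n, normalised (L n)) ->
  exists2 L', normalised L' &
    forall g, cont_on C g -> L n g @[n --> U] --> L' g.
Proof.
move=> UU hL.
exists (fun g => lim (L n g @[n --> U])); last first.
  move=> g cg; have [M _ gM] := cont_on_bounded cC cg.
  by apply: (ultra_bounded_cvg (M := M)); apply: filterE => n; exact: normalised_bound.
have Lc g : cont_on C g -> cvg (L n g @[n --> U]).
  move=> cg; have [M _ gM] := cont_on_bounded cC cg.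
  by apply: (ultra_bounded_cvg (M := M)); apply: filterE => n; exact: normalised_bound.
split; first split.
- move=> f g cf cg; rewrite -limD; [|exact: Lc|exact: Lc].
  congr (lim (_ @ U)); apply/funext => n /=.
  by have [hLn _] := hL n; rewrite (functionalD hLn).
- move=> c f cf; apply: cvg_lim => //.
  under eq_fun do rewrite (functionalZ (hL _).1)//.
  by apply: cvgM; [exact: cvg_cst|exact: Lc].
- move=> f cf f0; apply: limr_ge; first exact: Lc.
  by apply: filterE => n; have [hLn _] := hL n; exact: (functional_ge0 hLn).
- rewrite (_ : (fun n => L n (fun=> 1)) = fun=> 1); first exact: lim_cst.
  by apply/funext => n; have [] := hL n.
Qed.

End functional_limits.

Section strictly_convex.
Context {R : realType} {T : ptopologicalType} (C : set T) (cC : compact C).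
Variable (ev : nat -> T -> R).
Hypothesis cev : forall k, cont_on C (ev k).
Variable (mid : T -> T -> T).
Hypothesis Cmid : forall a b, C a -> C b -> C (mid a b).
Hypothesis midE : forall k a b, ev k (mid a b) = (ev k a + ev k b) / 2.

(** [F] is a weighted sum of the squares of the coordinates [ev k].  The square of
coordinate [k] has midpoint defect [(ev k a - ev k b) ^+ 2 / 4], and the weights make
the series converge uniformly on [C]. *)
Lemma strictly_convex_ex : exists (F : T -> R) (c : nat -> R),
  [/\ cont_on C F, forall k, 0 < c k &
      forall k a b, C a -> C b ->
        F (mid a b) + c k * (ev k a - ev k b) ^+ 2 <= (F a + F b) / 2].
Proof.
have /choice[M hM] k : exists M : R, 0 < M /\ forall x, C x -> `|ev k x| <= M.
  by have [M M0 h] := cont_on_bounded cC (@cev k); exists M.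
pose h (n : nat) : R := 2^-1 ^+ n.
have h0 n : 0 < h n by rewrite exprn_gt0// invr_gt0.
have hS n : h n = h n.+1 + h n.+1 by rewrite /h exprS; lra.
pose w k := h k.+1 / (M k) ^+ 2.
have w0 k : 0 < w k by rewrite divr_gt0// exprn_gt0// (hM k).1.
pose q k a := w k * (ev k a * ev k a).
have q0 k a : 0 <= q k a by rewrite mulr_ge0 ?(ltW (w0 k))// -expr2 sqr_ge0.
have qh k a : C a -> q k a <= h k.+1.
  move=> Ca; have [Mk0 /(_ a Ca) eM] := hM k.
  rewrite /q /w mulrAC ler_pdivrMr ?exprn_gt0// ler_wpM2l ?(ltW (h0 _))//.
  by rewrite -expr2 -real_normK ?num_real// ler_pXn2r// ?nnegrE// ltW.
have cq k : cont_on C (q k).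
  by apply: cont_onM; [exact: cont_on_cst|exact: cont_onM].
(* [h n] bounds the tail of the series from rank [n] on *)
pose S n a := \sum_(k < n) q k a.
have cS n : cont_on C (S n) by exact: cont_on_sum.
have SS n a : S n.+1 a = S n a + q n a by rewrite /S big_ord_recr.
have Sinc a : nondecreasing_seq (S ^~ a).
  by apply/nondecreasing_seqP => n; rewrite SS lerDl.
have Sdec a : C a -> nonincreasing_seq (fun n => S n a + h n).
  move=> Ca; apply/nonincreasing_seqP => n; rewrite SS (hS n).
  by rewrite -addrA lerD2l lerD2r qh.
have Scvg a : C a -> cvgn (S ^~ a).
  move=> Ca; apply: nondecreasing_is_cvgn => //; exists (S 0%N a + h 0%N) => _ [n _ <-].
  apply: (@le_trans _ _ (S n a + h n)); first by rewrite lerDl ltW.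
  exact: (Sdec a Ca).
pose F a := limn (S ^~ a).
have SF n a : C a -> S n a <= F a.
  by move=> Ca; apply: nondecreasing_cvgn_le => //; exact: Scvg.
have FS n a : C a -> F a <= S n a + h n.
  move=> Ca; apply: limr_le; first exact: Scvg.
  exists n => // m /= nm; apply: (@le_trans _ _ (S m a + h m)).
    by rewrite lerDl ltW.
  exact: (Sdec a Ca).
exists F, (fun k => w k / 4); split.
- apply/subspace_continuousP => a Ca; apply/cvgrPdist_lt => e e0.
  have [n hn] : exists n, h n < e / 3.
    have : h @ \oo --> (0 : R).
      by apply: cvg_expr; rewrite ger0_norm ?invr_ge0// invf_lt1// ltr1n.
    move=> /cvgr0Pnorm_lt/(_ (e / 3)); rewrite divr_gt0// => /(_ isT)[n _ H].
    by exists n; have := H n (leqnn n); rewrite /= ger0_norm ?ltW.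
  have /subspace_continuousP/(_ a Ca)/cvgrPdist_lt/(_ (e / 3)) := cS n.
  rewrite divr_gt0// => /(_ isT) H.
  near=> b.
  have Cb : C b by near: b; exact: withinT.
  have : `|S n a - S n b| < e / 3 by near: b.
  have := SF n a Ca; have := FS n a Ca; have := SF n b Cb; have := FS n b Cb.
  rewrite /from_subspace !ltr_norml => ? ? ? ? /andP[? ?].
  by apply/andP; split; lra.
- by move=> k; rewrite divr_gt0.
- move=> k a b Ca Cb; have Cm := Cmid Ca Cb.
  have qm j : q j (mid a b) + w j / 4 * (ev j a - ev j b) ^+ 2 = (q j a + q j b) / 2.
    rewrite /q midE !expr2; lra.
  have qm' j : q j (mid a b) <= (q j a + q j b) / 2.
    by rewrite -qm lerDl mulr_ge0 ?sqr_ge0// divr_ge0// ltW.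
  have Sm n : S n (mid a b) + (if (k < n)%N then w k / 4 * (ev k a - ev k b) ^+ 2 else 0)
      <= (S n a + S n b) / 2.
    elim: n => [|n IH]; first by rewrite ltn0 /S !big_ord0; lra.
    move: IH; rewrite !SS ltnS (leq_eqVlt k n); have := qm n; have := qm' n.
    have [<-|_] := eqVneq k n; first by rewrite ltnn /=; lra.
    by case: (k < n)%N => /=; lra.
  apply/ler_addgt0Pr => e e0.
  have [n hn] : exists n, h n < e.
    have : h @ \oo --> (0 : R).
      by apply: cvg_expr; rewrite ger0_norm ?invr_ge0// invf_lt1// ltr1n.
    move=> /cvgr0Pnorm_lt/(_ e e0)[n _ H].
    by exists n; have := H n (leqnn n); rewrite /= ger0_norm ?ltW.
  pose N := maxn n k.+1.
  have hN : h N <= h n by rewrite /h ler_wiXn2l// ?invr_ge0// ?invf_le1// ?ler1n// leq_maxl.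
  have := Sm N; rewrite (_ : (k < N)%N = true); last by rewrite leq_maxr.
  have := SF N a Ca; have := SF N b Cb; have := FS N _ Cm; lra.
Unshelve. all: by end_near.
Qed.

End strictly_convex.

(** * Extreme points and maximal functionals *)

Lemma cont_on_norm {R : realType} {T : topologicalType} (C : set T) (f : T -> R) :
  cont_on C f -> cont_on C (fun x => `|f x|).
Proof. by move=> cf x; apply: cvg_norm; exact: cf. Qed.

Lemma within_cozero {R : realType} {T : topologicalType} (C : set T) (g : T -> R)
  (c : T) : cont_on C g -> C c -> 0 < g c -> within C (nbhs c) [set x | 0 < g x].
Proof.
move=> /subspace_continuousP/(_ c) cg Cc g0.
by have /cvgr_gt := cg Cc; exact.
Qed.

Section choquet.
Context {R : realType} {X : topologicalType}.
Let T := ptwise X R.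
Variables (C : set T) (z : nat -> X).
Hypothesis cC : compact C.
Hypothesis convC : forall (a b : T) (t : R), C a -> C b -> 0 < t < 1 ->
  C (fun x => t * a x + (1 - t) * b x).
Hypothesis sepC : forall a b : T, C a -> C b ->
  (forall k, a (z k) = b (z k)) -> a = b.

Let ev (k : nat) (a : T) : R := a (z k).
Let mid (a b : T) : T := fun x => (a x + b x) / 2.

Let cev k : cont_on C (ev k).
Proof. by apply: continuous_subspaceT; exact: ptwise_eval_continuous. Qed.

Let Cmid a b : C a -> C b -> C (mid a b).
Proof.
move=> Ca Cb; have := @convC a b 2^-1 Ca Cb; rewrite (_ : 0 < 2^-1 < 1); last by lra.
move=> /(_ isT); congr C; apply/funext => x; rewrite /mid; lra.
Qed.

Let midE k a b : ev k (mid a b) = (ev k a + ev k b) / 2.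
Proof. by []. Qed.

(** The evaluations at [z k] separate [C], so these equations express that the
barycentre of [L] is [u]. *)
Definition barycentric (u : T) (L : (T -> R) -> R) : Prop :=
  normalised C L /\ forall k, L (ev k) = u (z k).

(** The supremum is attained at a limit of a maximising sequence; the set is nonempty
because evaluation at [u] belongs to it. *)
Lemma max_functional (F : T -> R) (u : T) : cont_on C F -> C u ->
  exists2 L, barycentric u L & forall L', barycentric u L' -> L' F <= L F.
Proof.
move=> cF Cu; have [M M0 FM] := cont_on_bounded cC cF.
pose S := [set L F | L in barycentric u].
have Su : S (F u).
  by exists (fun g => g u) => //; split => //; split => //; split => // f _; exact.
have Sub : ubound S M.
  move=> _ [L [hL _] <-]; rewrite (le_trans (ler_norm _))//.
  exact: (normalised_bound hL cF FM).
have supS : has_sup S by split; [exists (F u)|exists M].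
have /choice[L hL] n : exists L, barycentric u L /\ sup S - n.+1%:R^-1 < L F.
  have [|_ [L hL <-] LF] := @sup_adherent R S (n.+1%:R^-1) _ supS.
    by rewrite invr_gt0.
  by exists L.
have [U UU ooU] := ultrafilter_oo.
have [L' hL' LL'] := normalised_cluster cC UU (fun n => (hL n).1.1).
exists L'; first split => //.
  move=> k; have := LL' _ (@cev k).
  rewrite (_ : (fun n => L n (ev k)) = fun=> u (z k)); last first.
    by apply/funext => n; exact: (hL n).1.2.
  by move=> /(cvg_lim (@Rhausdorff R)) <-; rewrite lim_cst.
move=> L1 hL1.
have : sup S <= L' F.
  have c0 : (sup S - n.+1%:R^-1) @[n --> U] --> sup S - 0.
    apply: cvgB; first exact: cvg_cst.
    by apply: cvg_trans (cvg_harmonic (R := R)); apply: cvg_app.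
  rewrite -[leLHS]subr0; apply: ler_cvg_to c0 (LL' _ cF) _.
  by apply: filterE => n; rewrite ltW// (hL n).2.
by apply: le_trans; apply: ub_le_sup; [exists M|exists L1].
Qed.

(** Midpoints of segments that are long in a given coordinate: a countable exhaustion
of the points of [C] that are not extreme, by compact sets. *)
Definition midpoints (k : nat) (d : R) : set T :=
  [set c | exists a b, [/\ C a, C b, d <= a (z k) - b (z k) & c = mid a b]].

Lemma midpoints_sub k d : midpoints k d `<=` C.
Proof. by move=> _ [a [b [Ca Cb _ ->]]]; exact: Cmid. Qed.

Lemma midpoints_compact k d : compact (midpoints k d).
Proof.
pose f (p : T * T) := mid p.1 p.2.
pose B := [set p : T * T | d <= ev k p.1 - ev k p.2].
have c1 x : continuous (fun p : T * T => p.1 x).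
  move=> p; apply: (@cvg_comp _ _ _ fst (fun a : T => a x)); first exact: cvg_fst.
  exact: ptwise_eval_continuous.
have c2 x : continuous (fun p : T * T => p.2 x).
  move=> p; apply: (@cvg_comp _ _ _ snd (fun a : T => a x)); first exact: cvg_snd.
  exact: ptwise_eval_continuous.
rewrite (_ : midpoints k d = f @` (C `*` C `&` B)); last first.
  apply/seteqP; split => [_ [a [b [Ca Cb dab ->]]]|_ [[a b] [[/= Ca Cb] dab] <-]].
    by exists (a, b).
  by exists a, b.
have cf : continuous f.
  move=> p; have [_ ] := @ptwise_cvgP X R (f @ nbhs p) (f p) _; apply => x.
  have c3 : (fun=> 2^-1 : R) @ nbhs p --> (2^-1 : R) by exact: cvg_cst.
  by have := cvgM (cvgD (c1 x p) (c2 x p)) c3; exact.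
apply: continuous_compact; first exact: continuous_subspaceT.
apply: compact_closedI; first exact: compact_setX.
rewrite (_ : B = (fun p : T * T => ev k p.1 - ev k p.2) @^-1` [set x | d <= x]).
  apply: closed_comp; last exact: closed_ge.
  by move=> p _; exact: (cvgB (c1 _ p) (c2 _ p)).
by [].
Qed.

Section small_neighbourhoods.
Variables (F : T -> R) (cF : cont_on C F).

(** Positive at the points where [F] and the first [N] coordinates are close to their
values at [c]; being given by a continuous function, this neighbourhood of [c] is
measurable. *)
Definition gauge (N : nat) (c a : T) : R :=
  N.+1%:R^-1 - (\sum_(k < N) `|ev k a - ev k c| + `|F a - F c|).

Lemma cont_on_gauge N c : cont_on C (gauge N c).
Proof.
apply: cont_onB; first exact: cont_on_cst.
apply: cont_onD.
  apply: (@cont_on_sum _ _ C (fun k a => `|ev k a - ev k c|)) => k.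
  by apply/cont_on_norm/cont_onB; [exact: cev|exact: cont_on_cst].
by apply/cont_on_norm/cont_onB => //; exact: cont_on_cst.
Qed.

Lemma gauge_ev N c a k : 0 < gauge N c a -> (k < N)%N ->
  `|ev k a - ev k c| <= N.+1%:R^-1.
Proof.
rewrite subr_gt0 => /ltW h kN; apply: le_trans h.
rewrite (bigD1 (Ordinal kN))//= -addrA lerDl addr_ge0// sumr_ge0//.
Qed.

Lemma gauge_F N c a : 0 < gauge N c a -> `|F a - F c| <= N.+1%:R^-1.
Proof.
by rewrite subr_gt0 => /ltW h; apply: le_trans h; rewrite lerDr sumr_ge0.
Qed.

Lemma gauge_cover (A : set T) N : compact A -> A `<=` C ->
  exists cs : seq T, (forall c, c \in cs -> A c) /\
    forall a, A a -> exists2 c, c \in cs & 0 < gauge N c a.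
Proof.
move=> cA AC; apply: (@compact_cover_within T A (fun c a => 0 < gauge N c a)) => //.
move=> c Ac; have g0 : 0 < gauge N c c.
  by rewrite /gauge subrr normr0 addr0 big1 ?subr0// => k _; rewrite subrr normr0.
have : nbhs c [set x | C x -> 0 < gauge N c x].
  exact: (within_cozero (@cont_on_gauge N c) (AC _ Ac) g0).
by apply: (@filterS _ (nbhs c)) => x h Ax; exact/h/AC.
Qed.

End small_neighbourhoods.

(** Since countably many coordinates separate [C], a compact subset is the
intersection over [N] of finite unions of gauge neighbourhoods of its points. *)
Lemma compact_measurable_baire (A : set T) : compact A -> A `<=` C ->
  measurable (A : set (baire R C)).
Proof.
move=> cA AC; have cF : cont_on C (fun=> 0 : R) := @cont_on_cst _ _ C 0.
have /choice[cs hcs] N := gauge_cover cF N cA AC.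
pose V N := \bigcup_(c in [set` cs N]) [set a | 0 < gauge (fun=> 0) N c a].
have mV N : measurable (V N : set (baire R C)).
  rewrite /V bigcup_seq; apply: bigsetU_measurable => c _.
  by apply: measurable_cozero; exact: cont_on_gauge.
suff -> : A = C `&` \bigcap_N V N.
  by apply: measurableI; [exact: measurable_baire|exact: bigcapT_measurable].
apply/seteqP; split => [a Aa|a [Ca aV]].
  split; first exact: AC.
  by move=> N _; have [_ /(_ a Aa)[c cN ?]] := hcs N; exists c.
have /choice[c hc] N : exists c, A c /\ 0 < gauge (fun=> 0) N c a.
  by have [c /= cN ?] := aV N I; exists c; split => //; exact: (hcs N).1.
have [U UU ooU] := ultrafilter_oo.
move: (cA); rewrite compact_ultra => /(_ (c @ U) (ultra_fmap c UU))[].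
  by apply: (@filterE _ U) => n; exact: (hc n).1.
move=> b [Ab /ptwise_cvgP cb]; suff -> : a = b by [].
apply: sepC => //; first exact: AC.
move=> k; apply/eqP; rewrite -subr_eq0 -normr_le0.
have c1 : `|a (z k) - c N (z k)| @[N --> U] --> `|a (z k) - b (z k)|.
  by apply: cvg_norm; apply: cvgB; [exact: cvg_cst|exact: cb].
have c0 : N.+1%:R^-1 @[N --> U] --> (0 : R).
  by apply: cvg_trans (cvg_harmonic (R := R)); apply: cvg_app.
apply: ler_cvg_to c1 c0 _; apply: ooU; exists k.+1 => // N /= kN.
exact: (gauge_ev (hc N).2 kN).
Qed.

(** If a point divides a segment in the ratio [t : 1 - t], shortening the longer part
makes it a midpoint. *)
Lemma not_extreme_midpoint (c : T) : C c -> ~ extreme_points (C : set (X -> R)) c ->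
  exists k j, midpoints k (j.+1%:R^-1) c.
Proof.
move=> Cc; apply: contra_notP => nmid; split => // h1 h2 t C1 C2 t01 cE.
have sym a b : C a -> C b -> c = mid a b -> a = b.
  move=> Ca Cb cab; apply: sepC => // k.
  wlog ab : a b Ca Cb cab / b (z k) <= a (z k).
    have [ab|/ltW ab] := leP (b (z k)) (a (z k)); first exact.
    move=> /(_ b a Cb Ca _ ab) -> //; rewrite cab.
    by apply/funext => x; rewrite /mid addrC.
  apply/eqP; rewrite eq_le ab andbT leNgt; apply/negP => lt; apply: nmid.
  exists k; have d0 : 0 < a (z k) - b (z k) by rewrite subr_gt0.
  exists (Num.truncn (a (z k) - b (z k))^-1), a, b; split => //.
  by rewrite invf_ple ?posrE// ltW// truncnS_gt.
have cEx x : c x = t * h1 x + (1 - t) * h2 x by rewrite cE.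
have h12 : (h1 : T) = h2.
  have [t0 t1] := andP t01; have [tle|tlt] := leP t 2^-1.
    have C12 : C (fun x => (2 * t) * h1 x + (1 - 2 * t) * h2 x).
      have [teq|tneq] := eqVneq t 2^-1.
        rewrite (_ : (fun _ => _) = h1)//; apply/funext => x; rewrite teq; lra.
      apply: convC => //; apply/andP; split; first lra.
      by move: tneq tle; rewrite le_eqVlt => /negbTE -> /=; lra.
    have cm : c = mid (fun x => (2 * t) * h1 x + (1 - 2 * t) * h2 x) h2.
      by apply/funext => x; rewrite cEx /mid; lra.
    have e := sym _ _ C12 C2 cm; apply/funext => x.
    have := congr1 (fun f => f x) e => /= ex.
    have : 2 * t * (h1 x - h2 x) = 0 by lra.
    move=> /eqP; rewrite mulf_eq0 mulf_eq0 pnatr_eq0/= (gt_eqF t0)/= subr_eq0.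
    by move=> /eqP.
  have C12 : C (fun x => (2 * t - 1) * h1 x + (1 - (2 * t - 1)) * h2 x).
    by apply: convC => //; apply/andP; split; lra.
  have cm : c = mid h1 (fun x => (2 * t - 1) * h1 x + (1 - (2 * t - 1)) * h2 x).
    by apply/funext => x; rewrite cEx /mid; lra.
  have e := sym _ _ C1 C12 cm; apply/funext => x.
  have := congr1 (fun f => f x) e => /= ex.
  have : 2 * (1 - t) * (h1 x - h2 x) = 0 by lra.
  move=> /eqP; rewrite mulf_eq0 mulf_eq0 pnatr_eq0/= subr_eq0 (gt_eqF t1)/= subr_eq0.
  by move=> /eqP.
have cE1 : c = h1 by apply/funext => x; rewrite cEx -h12; lra.
by rewrite cE1; split => //; rewrite -h12.
Qed.

Section split_measure.
Variables (m : {finite_measure set (baire R C) -> \bar R}) (A : set T).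
Hypothesis mA : measurable (A : set (baire R C)).
Hypothesis AC : A `<=` C.
Hypothesis intm : forall f, cont_on C f ->
  m.-integrable C (EFin \o f : baire R C -> \bar R).
Variables (s : seq (R * T)) (al be : T -> T).
Hypothesis s_ge0 : forall p, p \in s -> 0 <= p.1.
Hypothesis sA : forall p, p \in s -> C (al p.2) /\ C (be p.2).
Hypothesis s_sum : \sum_(p <- s) p.1 = fine (m A).
Hypothesis mC1 : fine (m C) = 1.

(** Integration against the part of [m] outside [A], the part in [A] being replaced
by masses placed half and half at the ends [al] and [be] of segments whose midpoints
are nodes of a quadrature of that part. *)
Definition split_functional (g : T -> R) : R :=
  \int[m]_(x in C `\` A) g x +
  \sum_(p <- s) p.1 * ((g (al p.2) + g (be p.2)) / 2).

Let mC : measurable (C : set (baire R C)) := @measurable_baire _ _ C.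
Let mD : measurable (C `\` A : set (baire R C)).
Proof. exact: measurableD. Qed.

Lemma integrable_setDl f : cont_on C f ->
  m.-integrable (C `\` A) (EFin \o f : baire R C -> \bar R).
Proof. by move=> /intm; apply: integrableS => //; exact: subDsetl. Qed.

Lemma Rintegral_setDl f : cont_on C f ->
  \int[m]_(x in C) f x = \int[m]_(x in C `\` A) f x + \int[m]_(x in A) f x.
Proof.
move=> cf; have CE : (C `\` A) `|` A = C by rewrite setUC setDUK.
rewrite -Rintegral_setU ?CE//; first exact: intm.
by apply/disj_set2P; apply/seteqP; split => // x [[]].
Qed.

Lemma split_functional_normalised : normalised C split_functional.
Proof.
split; first split.
- move=> f g cf cg; rewrite /split_functional.
  rewrite RintegralD//; [|exact: integrable_setDl|exact: integrable_setDl].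
  rewrite addrACA -big_split/=; congr (_ + _); apply: eq_bigr => p _; lra.
- move=> c f cf; rewrite /split_functional RintegralZl//; last exact: integrable_setDl.
  rewrite mulrDr mulr_sumr; congr (_ + _); apply: eq_bigr => p _; lra.
- move=> f cf f0; rewrite addr_ge0//.
    by apply: Rintegral_ge0 => x [Cx _]; exact: f0.
  rewrite big_seq sumr_ge0// => p ps; have [Ca Cb] := sA ps.
  by rewrite mulr_ge0 ?s_ge0// divr_ge0// addr_ge0// f0.
- rewrite /split_functional.
  rewrite (eq_bigr (fun p => p.1)); last by move=> p _; lra.
  have := @Rintegral_setDl _ (@cont_on_cst _ _ C 1).
  rewrite !Rintegral_cst// !mul1r mC1 s_sum => <-.
  by [].
Qed.

End split_measure.

(** Suppose that the set [A] of midpoints has positive mass.  Replacing the mass near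
a node of a quadrature by masses at the ends of a segment centred at the node
changes the coordinates by at most the quadrature error and raises the value at [F]
by at least [m A * c k * d ^+ 2], up to that error.  A limit of such functionals over
finer and finer quadratures has barycentre [u] and contradicts the maximality of
[L]. *)
Lemma max_measure_midpoints (F : T -> R) (c : nat -> R) (u : T)
    (L : (T -> R) -> R) (m : {finite_measure set (baire R C) -> \bar R}) k j :
  cont_on C F -> (forall k, 0 < c k) ->
  (forall k a b, C a -> C b ->
     F (mid a b) + c k * (a (z k) - b (z k)) ^+ 2 <= (F a + F b) / 2) ->
  barycentric u L ->
  (forall L', barycentric u L' -> L' F <= L F) ->
  m C = (L (fun=> 1))%:E ->
  (forall f, cont_on C f ->
     m.-integrable C (EFin \o f : baire R C -> \bar R) /\
     (\int[m]_(x in C) (f x)%:E = (L f)%:E)%E) ->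
  m (midpoints k j.+1%:R^-1) = 0%E.
Proof.
move=> cF c0 Fc hL Lmax mC mI; set d := j.+1%:R^-1; set A := midpoints k d.
have d0 : 0 < d by rewrite invr_gt0.
have AC : A `<=` C by exact: midpoints_sub.
have cA : compact A by exact: midpoints_compact.
have mA : measurable (A : set (baire R C)) by exact: compact_measurable_baire.
have mC1 : fine (m C) = 1 by rewrite mC hL.1.2.
have intm f (cf : cont_on C f) := (mI f cf).1.
have IL f : cont_on C f -> \int[m]_(x in C) f x = L f.
  by move=> /mI[_ h]; rewrite /Rintegral h.
apply/eqP; rewrite -measure_le0 leNgt; apply/negP => mA0.
have a0 : 0 < fine (m A) by rewrite fine_gt0// mA0/= -ge0_fin_numE// fin_num_measure.
have /choice[al hal] (x : T) : exists a : T, A x ->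
    exists b, [/\ C a, C b, d <= a (z k) - b (z k) & x = mid a b].
  by have [[a ?]|nA] := pselect (A x); [exists a|exists x].
have /choice[be hbe] (x : T) : exists b : T, A x ->
    [/\ C (al x), C b, d <= al x (z k) - b (z k) & x = mid (al x) b].
  by have [/hal[b ?]|nA] := pselect (A x); [exists b|exists x].
have c1 : cont_on C (fun=> 1 : R) := @cont_on_cst _ _ C 1.
have int1 : m.-integrable A (EFin \o (fun=> 1) : baire R C -> \bar R).
  by apply: integrableS (intm _ c1) => //; exact: measurable_baire.
have I1 : \int[m]_(x in A) 1 = fine (m A) by rewrite Rintegral_cst ?mul1r.
have /choice[s hs] N : exists s : seq (R * T),
  [/\ forall p, p \in s -> A p.2,
      forall p, p \in s -> 0 <= p.1,
      \sum_(p <- s) p.1 = fine (m A) &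
      forall g : T -> R, cont_on C g ->
        (forall a b, A a -> A b -> 0 < gauge F N b a -> `|g a - g b| <= N.+1%:R^-1) ->
        `|\int[m]_(x in A) g x - \sum_(p <- s) p.1 * g p.2| <=
           N.+1%:R^-1 * fine (m A)].
  have [cs [csA Acs]] := gauge_cover cF N cA AC.
  have mO x : measurable ([set a | 0 < gauge F N x a] : set (baire R C)).
    by apply: measurable_cozero; exact: cont_on_gauge.
  have [s [scs s0 ssum sg]] := @quadrature _ (baire R C) R m _ mO (fun=> 1) cs A mA Acs int1.
  exists s; split.
  - by move=> p /scs /csA.
  - by move=> p ps; exact: s0.
  - by rewrite ssum.
  - move=> g cg gN.
    have E : \int[m]_(x in A) g x = \int[m]_(x in A) (g x * 1).
      by apply: eq_Rintegral => x _; rewrite mulr1.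
    rewrite E -I1.
    have -> : \int[m]_(x in A) 1 = \int[m]_(x in A) `|1|.
      by apply: eq_Rintegral => x _; rewrite normr1.
    apply: sg.
      under eq_fun do rewrite mulr1.
      by apply: integrableS (intm _ cg) => //; exact: measurable_baire.
    by move=> b a /csA Ab Aa; exact: gN.
pose Ln N := split_functional m A (s N) al be.
have Cab N p : p \in s N -> C (al p.2) /\ C (be p.2).
  by have [sA _ _ _] := hs N; move=> /sA /hbe[].
have nLn N : normalised C (Ln N).
  have [sA s0 ssum _] := hs N.
  by apply: split_functional_normalised => // p; exact: Cab.
have evLn N i : (i < N)%N -> `|Ln N (ev i) - u (z i)| <= N.+1%:R^-1 * fine (m A).
  move=> iN; have [sA s0 ssum sg] := hs N.
  have -> : u (z i) = \int[m]_(x in C `\` A) ev i x + \int[m]_(x in A) ev i x.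
    rewrite -(hL.2 i) -(Rintegral_setDl mA AC intm (@cev i)); exact/esym/IL/cev.
  rewrite /Ln /split_functional opprD addrACA subrr add0r distrC.
  have -> : \sum_(p <- s N) p.1 * ((ev i (al p.2) + ev i (be p.2)) / 2) =
      \sum_(p <- s N) p.1 * ev i p.2.
    rewrite big_seq [RHS]big_seq; apply: eq_bigr => p /sA /hbe[_ _ _ e].
    by congr (_ * _); rewrite {3}/ev {3}e.
  by apply: sg => // a b Aa Ab g; exact: (gauge_ev g iN).
pose gain := fine (m A) * (c k * d ^+ 2).
have gain0 : 0 < gain by rewrite mulr_gt0// mulr_gt0// exprn_gt0.
have FLn N : L F - N.+1%:R^-1 * fine (m A) + gain <= Ln N F.
  have [sA s0 ssum sg] := hs N.
  rewrite -IL// (Rintegral_setDl mA AC intm cF) /Ln /split_functional.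
  have := sg F cF (fun a b _ _ g => gauge_F g).
  have : \sum_(p <- s N) p.1 * (F p.2 + c k * d ^+ 2) <=
      \sum_(p <- s N) p.1 * ((F (al p.2) + F (be p.2)) / 2).
    rewrite big_seq [leRHS]big_seq; apply: ler_sum => p ps.
    have [Ca Cb dab e] := hbe _ (sA _ ps).
    rewrite ler_wpM2l ?s0// {1}e; apply: le_trans (Fc k _ _ Ca Cb).
    rewrite lerD2l ler_wpM2l ?(ltW (c0 k))// ler_pXn2r ?nnegrE ?(ltW d0)//.
    by rewrite (le_trans (ltW d0)).
  rewrite (eq_bigr (fun p => p.1 * F p.2 + p.1 * (c k * d ^+ 2))); last first.
    by move=> p _; rewrite mulrDr.
  rewrite big_split/= -mulr_suml ssum -/gain ler_norml => h /andP[_ h2].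
  by rewrite -!addrA lerD2l addrA (le_trans _ h)// lerD2r lerBlDr -lerBlDl.
have [U UU ooU] := ultrafilter_oo.
have [L' nL' LL'] := normalised_cluster cC UU nLn.
have e0 : N.+1%:R^-1 * fine (m A) @[N --> U] --> (0 * fine (m A) : R).
  apply: cvgM; last exact: cvg_cst.
  by apply: cvg_trans (cvg_harmonic (R := R)); apply: cvg_app.
have hL' : barycentric u L'.
  split => // i; apply/eqP; rewrite -subr_eq0 -normr_le0.
  have l1 : `|Ln N (ev i) - u (z i)| @[N --> U] --> `|L' (ev i) - u (z i)|.
    by apply: cvg_norm; apply: cvgB; [exact: LL'|exact: cvg_cst].
  rewrite -(mul0r (fine (m A))); apply: ler_cvg_to l1 e0 _.
  by apply: ooU; exists i.+1 => // N /= iN; exact: evLn.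
have : L F - 0 * fine (m A) + gain <= L' F.
  apply: ler_cvg_to (LL' _ cF) _; last by apply: filterE => N; exact: FLn.
  by apply: cvgD; [apply: cvgB => //; exact: cvg_cst|exact: cvg_cst].
have := Lmax _ hL'; lra.
Qed.

(** Choquet's theorem for a compact convex set of functions on which countably many
evaluations are injective. *)
Theorem choquet (u : T) : C u ->
  exists (m : {finite_measure set (baire R C) -> \bar R}) (E : set (baire R C)),
  [/\ measurable E /\ m (~` E) = 0%E,
      E `<=` (extreme_points (C : set (X -> R)) : set T),
      fine (m E) = 1 &
      forall k, m.-integrable E (fun a => (a (z k))%:E) /\
        \int[m]_(a in E) a (z k) = u (z k)].
Proof.
move=> Cu.
have [F [c [cF c0 Fc]]] := strictly_convex_ex cC cev Cmid (fun _ _ _ => erefl).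
have [L hL Lmax] := max_functional cF Cu.
have [m [mCc mCL mI]] := riesz_representation hL.1.1 cC.
pose N := \bigcup_k \bigcup_j midpoints k j.+1%:R^-1.
have mMid k j : measurable (midpoints k j.+1%:R^-1 : set (baire R C)).
  apply: compact_measurable_baire => //.
    exact: midpoints_compact.
  exact: midpoints_sub.
have mN : measurable (N : set (baire R C)).
  by apply: bigcupT_measurable => k; exact: bigcupT_measurable.
have mC : measurable (C : set (baire R C)) by exact: measurable_baire.
have N0 : m N = 0%E.
  apply: measure_negligible => //; apply: negligible_bigcup => k.
  apply: negligible_bigcup => j; apply/negligibleP => //.
  exact: max_measure_midpoints Lmax _ _.
have mE : measurable (C `\` N : set (baire R C)) by exact: measurableD.
have NC : N `<=` C by move=> a [k _ [j _ /midpoints_sub]]; exact.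
have mE1 : fine (m (C `\` N)) = 1.
  have moo : (m C < +oo)%E by rewrite -ge0_fin_numE// fin_num_measure.
  have CN : C `&` N = N by apply/seteqP; split => [a []|a Na]; last by split => //; exact: NC.
  by rewrite (measureD mC mN moo) CN [X in (_ - X)%E]N0 sube0 [X in fine X]mCL hL.1.2.
exists m, (C `\` N); split.
- split => //; apply/eqP; rewrite -measure_le0 setCD.
  apply: le_trans (measureU2 _ _ _) _ => //; first exact: measurableC.
  by rewrite [X in (X + _)%E](_ : _ = 0%E)// [X in (_ + X)%E](_ : _ = 0%E)// adde0.
- move=> a [Ca Na]; apply: contrapT => /(not_extreme_midpoint Ca)[k [j ?]].
  by apply: Na; exists k => //; exists j.
- by rewrite mE1.
- move=> k; have [intk Ik] := mI _ (@cev k); split.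
    by apply: integrableS intk => //; exact: subDsetl.
  rewrite -hL.2; have -> : L (ev k) = \int[m]_(a in C) ev k a by rewrite /Rintegral Ik.
  have CE : (C `\` N) `|` N = C by rewrite setUC setDUK.
  have E : \int[m]_(a in (C `\` N) `|` N) ev k a =
      \int[m]_(a in C `\` N) ev k a + \int[m]_(a in N) ev k a.
    apply: Rintegral_setU => //; first by rewrite CE.
    by apply/disj_set2P; apply/seteqP; split => // x [[]].
  rewrite CE in E; rewrite E [X in _ = _ + X](_ : _ = 0) ?addr0//.
  rewrite /Rintegral null_set_integral//.
  by apply: measurable_funS (measurable_int _ intk).
Qed.

End choquet.

(** * Finite measures on metric spaces *)

Section finite_measure_tools.
Context {d} {T : measurableType d} {R : realType}.
Variables (m : {finite_measure set T -> \bar R}) (A : set T) (mA : measurable A).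

Lemma finite_measure_lty : (m A < +oo)%E.
Proof. by rewrite -ge0_fin_numE// fin_num_measure. Qed.

Lemma rintegrable_bounded (f : T -> R) (M : R) : measurable_fun A f ->
  (forall x, A x -> `|f x| <= M) -> m.-integrable A (EFin \o f).
Proof.
move=> mf fM; apply: measurable_bounded_integrable => //.
  exact: finite_measure_lty.
exists M; split; first exact: num_real.
by move=> N MN x Ax /=; rewrite (le_trans (fM _ Ax))// ltW.
Qed.

Lemma EFin_Rintegral (f : T -> R) : m.-integrable A (EFin \o f) ->
  (\int[m]_(x in A) (f x)%:E)%E = (\int[m]_(x in A) f x)%:E.
Proof. by move=> intf; rewrite /Rintegral fineK//; exact: integrable_fin_num. Qed.

Lemma bounded_cvg (f_ : nat -> T -> R) (f : T -> R) (M : R) :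
  (forall n, measurable_fun A (f_ n)) ->
  (forall x, A x -> f_ n x @[n --> \oo] --> f x) ->
  (forall n x, A x -> `|f_ n x| <= M) ->
  m.-integrable A (EFin \o f) /\
  \int[m]_(x in A) f_ n x @[n --> \oo] --> \int[m]_(x in A) f x.
Proof.
move=> mf_ cf fM; have mf : measurable_fun A f := measurable_fun_cvg mf_ cf.
have fM' x : A x -> `|f x| <= M.
  have cM : (fun=> M) @ \oo --> M by exact: cvg_cst.
  move=> Ax.
  have c1 : `|f_ n x| @[n --> \oo] --> `|f x| by apply: cvg_norm; exact: cf.
  apply: (ler_cvg_to c1 cM).
  by apply: nearW => n; exact: fM.
have intf := rintegrable_bounded mf fM'; split => //.
have intn n := rintegrable_bounded (mf_ n) (fM n).
have h : (\int[m]_(x in A) (f_ n x)%:E @[n --> \oo] -->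
    \int[m]_(x in A) (f x)%:E)%E.
  apply: (@dominated_cvg _ _ _ m A mA _ _ (cst M%:E)).
  - by move=> n; exact/measurable_EFinP.
  - by move=> x Ax; apply: cvg_EFin; [exact: nearW|exact: cf].
  - by move=> x _.
  - apply: (@rintegrable_bounded (cst M) M) => //.
    by move=> x Ax; rewrite /= ger0_norm// (le_trans _ (fM 0%N x Ax)).
  - by move=> n x Ax; rewrite /= lee_fin fM.
rewrite (EFin_Rintegral intf) in h.
move: h; under eq_fun do rewrite (EFin_Rintegral (intn _)).
by move=> /fine_cvgP[_]; exact.
Qed.

Lemma Rintegral_carried (f : T -> R) : m (~` A) = 0%E ->
  m.-integrable setT (EFin \o f) -> \int[m]_x f x = \int[m]_(x in A) f x.
Proof.
move=> mA0 intf; rewrite -(setUv A) Rintegral_setU ?setUv//; last 2 first.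
- exact: measurableC.
- by apply/disj_set2P; rewrite setICr.
rewrite [X in _ + X](_ : _ = 0) ?addr0// /Rintegral null_set_integral//.
  exact: measurableC.
exact: measurable_funTS (measurable_int m intf).
Qed.

Lemma Rintegral_eq0_ae (f : T -> R) : m.-integrable A (EFin \o f) ->
  (forall x, A x -> 0 <= f x) ->
  \int[m]_(x in A) f x = 0 <-> ae_eq m A (EFin \o f) (cst 0%E).
Proof.
move=> intf f0; have mf := measurable_int m intf.
rewrite -(ae_eq_integral_abs m mA mf).
have -> : (\int[m]_(x in A) `|(EFin \o f) x| = \int[m]_(x in A) (f x)%:E)%E.
  by apply: eq_integral => x /[!inE] Ax /=; rewrite ger0_norm// f0.
by rewrite EFin_Rintegral//; split => [->//|[]].
Qed.

End finite_measure_tools.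

Section borel_tools.
Context {R : realType} {T : ptopologicalType}.

Lemma borel_open (A : set T) : open A -> measurable (A : set (borel T)).
Proof. by move=> oA; exact: sub_sigma_algebra. Qed.

Lemma borel_closed (A : set T) : closed A -> measurable (A : set (borel T)).
Proof.
move=> cA; rewrite -(setCK A); apply: (@measurableC _ (borel T)).
by apply: borel_open; exact: closed_openC.
Qed.

Lemma borel_within (A : set T) (f : T -> R) : measurable (A : set (borel T)) ->
  {within A, continuous f} -> measurable_fun (A : set (borel T)) (f : borel T -> R).
Proof.
move=> mA cf; apply: (measurability _ (RGenOpens.measurableE R)).
move=> _ [_ [a [b ->]] <-].
have oab : open (`]a, b[%classic : set R) by exact: itv_open.
move/continuousP : cf => /(_ _ oab).
rewrite open_subspaceP => -[V oV VA].
rewrite setIC -[X in measurable X]VA.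
by apply: measurableI => //; exact: borel_open.
Qed.

Lemma borel_into {S : ptopologicalType} {d} {M : measurableType d} (A : set M)
    (f : M -> S) : measurable A ->
  (forall O, open O -> measurable (A `&` f @^-1` O)) ->
  measurable_fun A (f : M -> borel S).
Proof.
move=> mA H; apply: (@measurability _ _ _ (borel S) A f (@open S)) => //.
by move=> _ [V oV <-]; exact: H.
Qed.

End borel_tools.

Section metric_tools.
Context {R : realType} {T : pmetricType R}.

(** [phi] is the distance to [F], or the constant [1] when [F] is empty. *)
Lemma closed_zero_set (F : set T) : closed F -> exists phi : T -> R,
  [/\ continuous phi, forall x, 0 <= phi x & forall x, F x <-> phi x = 0].
Proof.
move=> cF; have [F0|F0] := pselect (F !=set0); last first.
  exists (fun=> 1); split => //; first by move=> x; exact: cvg_cst.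
  by move=> x; split => [Fx|/eqP]; [exfalso; apply: F0; exists x|rewrite oner_eq0].
pose S x := [set mdist x a | a in F].
have S0 x : has_inf (S x).
  split; first by have [a Fa] := F0; exists (mdist x a), a.
  by exists 0 => _ [a _ <-]; exact: mdist_ge0.
pose phi x : R := inf (S x).
have phi_le x a : F a -> phi x <= mdist x a.
  by move=> Fa; apply: ge_inf; [exact: (S0 x).2|exists a].
have phi_ge x (c : R) : (forall a, F a -> c <= mdist x a) -> c <= phi x.
  move=> h; apply: lb_le_inf; first exact: (S0 x).1.
  by move=> _ [a Fa <-]; exact: h.
have phi_lip x y : phi x <= mdist x y + phi y.
  rewrite -lerBlDl; apply: phi_ge => a Fa; rewrite lerBlDl.
  by rewrite (le_trans (phi_le x a Fa))// metric_triangle.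
exists phi; split.
- move=> x; apply/cvgrPdist_lt => e e0.
  have : nbhs x (ball x e) by exact: nbhsx_ballx.
  apply: filterS => y; rewrite ballEmdist /= => xy.
  have := phi_lip x y; have := phi_lip y x; rewrite metric_sym => h1 h2.
  by rewrite ltr_norml; apply/andP; split; lra.
- by move=> x; apply: phi_ge => a _; exact: mdist_ge0.
- move=> x; split => [Fx|phi0].
    by apply/eqP; rewrite eq_le phi_ge ?andbT => [|a _]; rewrite ?mdist_ge0// -(mdistxx x) phi_le.
  apply: cF => B /nbhs_ballP[e /= e0 Be].
  have [_ [a Fa <-]] := inf_adherent e0 (S0 x).
  rewrite -/(phi x) phi0 add0r => xa; exists a; split => //.
  by apply: Be; rewrite ballEmdist.
Qed.

Lemma closed_bumps (F : set T) : closed F -> exists g : nat -> T -> R,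
  [/\ forall k, continuous (g k), forall k x, 0 <= g k x <= 1 &
      forall x, g k x @[k --> \oo] --> (\1_F x : R)].
Proof.
move=> /closed_zero_set[phi [cphi phi0 phiF]].
exists (fun k x => Num.max 0 (1 - k%:R * phi x)); split.
- move=> k x; apply: (@continuous_max _ _ (fun=> 0) (fun x => 1 - k%:R * phi x)).
    exact: cvg_cst.
  by apply: cvgB; [exact: cvg_cst|apply: cvgM; [exact: cvg_cst|exact: cphi]].
- move=> k x; rewrite le_max lexx/= ge_max ler01/= gerBl mulr_ge0//.
- move=> x; have [Fx|nFx] := pselect (F x).
    rewrite indicE mem_set//; apply: cvg_near_cst; apply: nearW => k.
    by rewrite ((phiF x).1 Fx) mulr0 subr0 max_r.
  rewrite indicE memNset//; apply: cvg_near_cst.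
  have px : 0 < phi x.
    by rewrite lt_neqAle phi0 andbT eq_sym; apply/eqP => /phiF.
  exists (Num.truncn (phi x)^-1).+1 => // k /= kx.
  apply/max_l; rewrite subr_le0 -ler_pdivrMr// div1r.
  by rewrite (le_trans (ltW (truncnS_gt _)))// ler_nat.
Qed.

(** Continuous functions determine the measures of closed sets, whose indicators are
limits of [closed_bumps], and closed sets are stable under intersection and generate
the Borel sets. *)
Lemma finite_measure_unique (m1 m2 : {finite_measure set (borel T) -> \bar R}) :
  (forall f : T -> R, continuous f -> (forall x, 0 <= f x <= 1) ->
     \int[m1]_x f x = \int[m2]_x f x) ->
  forall A, measurable A -> m1 A = m2 A.
Proof.
move=> H.
have Hc (F : set T) : closed F -> m1 F = m2 F.
  move=> cF; have [g [cg g01 gF]] := closed_bumps cF.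
  have mF := borel_closed cF.
  have mg k : measurable_fun [set: borel T] (g k : borel T -> R).
    by apply: borel_within => //; exact: continuous_subspaceT.
  have gb k (x : borel T) : setT x -> `|g k x| <= 1.
    by move=> _; have /andP[? ?] := g01 k x; rewrite ger0_norm.
  have gF' (x : borel T) : setT x -> g k x @[k --> \oo] --> (\1_F x : R).
    by move=> _; exact: gF.
  have [_ c1] := bounded_cvg m1 measurableT mg gF' gb.
  have [_ c2] := bounded_cvg m2 measurableT mg gF' gb.
  have : \int[m1]_x (\1_F x : R) = \int[m2]_x (\1_F x : R).
    have E : (fun k => \int[m1]_x g k x) = (fun k => \int[m2]_x g k x).
      by apply/funext => k; exact: H.
    by rewrite E in c1; apply: (cvg_unique _ c1 c2); exact: Rhausdorff.
  rewrite /Rintegral !integral_indic// !setIT => e.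
  by rewrite -(fineK (fin_num_measure m1 _ mF)) -(fineK (fin_num_measure m2 _ mF)) e.
move=> A mA; apply: (@measure_unique _ R (borel T) (@closed T) (fun=> setT) _ _ _ _ m1 m2) => //.
- apply/seteqP; split; apply: smallest_sub; try exact: smallest_sigma_algebra.
    move=> O oO; rewrite -(setCK O).
    apply: (@measurableC _ (g_sigma_algebraType (@closed T))).
    by apply: sub_sigma_algebra; exact: open_closedC.
  by move=> F cF; exact: borel_closed.
- by move=> ? ? ? ?; exact: closedI.
- by apply/seteqP; split => // x _; exists 0%N.
- by move=> k; exact: finite_measure_lty.
Qed.

End metric_tools.

(** * Equicontinuous families and their mixtures *)

Section equicontinuity.
Context {R : realType} {X : pmetricType R}.
Implicit Types (D B : set X) (P : set (X -> R)) (f g h : X -> R).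

Definition equicont D P : Prop := forall x, D x -> forall e : R, 0 < e ->
  \forall y \near x, forall h, P h -> `|h y - h x| <= e.

Lemma equicont_within D P B h : equicont D P -> P h -> B `<=` D ->
  {within B, continuous h}.
Proof.
move=> eP Ph BD; apply/subspace_continuousP => x Bx; apply: cvg_within_filter.
apply/cvgrPdist_le => e e0.
by have := eP x (BD x Bx) e e0; apply: filterS => y /(_ h Ph); rewrite distrC.
Qed.

Section compact_set.
Variables (B : set X) (cB : compact B).

Lemma compact_borel : measurable (B : set (borel X)).
Proof.
by apply: borel_closed; apply: compact_closed => //; exact: metric_hausdorff.
Qed.

Lemma integrable_within (m : {finite_measure set (borel X) -> \bar R}) h :
  {within B, continuous h} -> m.-integrable B (EFin \o h : borel X -> \bar R).
Proof.
move=> ch; have [M _ hM] := cont_on_bounded cB ch.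
apply: (rintegrable_bounded m compact_borel _ hM).
by apply: borel_within => //; exact: compact_borel.
Qed.

Lemma integrable_withinM (m : {finite_measure set (borel X) -> \bar R}) h f :
  {within B, continuous h} -> m.-integrable B (EFin \o f : borel X -> \bar R) ->
  m.-integrable B (fun x : borel X => (h x * f x)%:E).
Proof.
move=> ch intf; have [M _ hM] := cont_on_bounded cB ch.
have mh : measurable_fun (B : set (borel X)) (h : borel X -> R).
  by apply: borel_within => //; exact: compact_borel.
have bh : [bounded h x | x in (B : set (borel X))].
  exists M; split; first exact: num_real.
  by move=> N MN x Bx /=; rewrite (le_trans (hM _ Bx))// ltW.
have := integrableMr compact_borel mh bh intf.
by apply: eq_integrable => //; exact: compact_borel.
Qed.

(** One finite sum approximates the integrals of all members of an equicontinuous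
family.  It reduces statements on integrals to statements on evaluations at finitely
many points. *)
Lemma cubature D P (m : {finite_measure set (borel X) -> \bar R}) f (e : R) :
  B `<=` D -> equicont D P ->
  m.-integrable B (EFin \o f : borel X -> \bar R) -> 0 < e ->
  exists2 s : seq (R * X), (forall p, p \in s -> B p.2) &
    forall h, P h -> `|\int[m]_(x in B) (h x * f x) - \sum_(p <- s) p.1 * h p.2| <=
      e * \int[m]_(x in B) `|f x|.
Proof.
move=> BD eP intf e0.
pose V (c : X) := [set y | forall h, P h -> `|h y - h c| <= e]°.
have [cs [csB Bcs]] : exists cs : seq X, (forall c, c \in cs -> B c) /\
    forall a, B a -> exists2 c, c \in cs & V c a.
  apply: compact_cover_within => // c Bc.
  apply: (@filterS _ (nbhs c) _ (V c)); first by move=> y + _; exact.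
  by apply: open_nbhs_nbhs; split; [exact: open_interior|exact/eP/e0/BD].
have mV c : measurable (V c : set (borel X)) by apply: borel_open; exact: open_interior.
have [s [scs _ _ sP]] :=
  @quadrature _ (borel X) R m V mV f cs B compact_borel Bcs intf.
exists s; first by move=> p /scs /csB.
move=> h Ph; apply: sP.
  apply: integrable_withinM => //; exact: (equicont_within eP Ph BD).
by move=> c a _ _ /interior_subset; exact.
Qed.

End compact_set.

Section mixtures.
Context {d} {S : measurableType d}.
Variables (nu : {finite_measure set S -> \bar R}) (A : set S) (mA : measurable A).
Variables (D : set X) (oD : open D) (G : S -> X -> R).
Hypothesis eG : equicont D [set G s | s in A].
Hypothesis mG : forall x, D x -> measurable_fun A (fun s => G s x).
Hypothesis bG : forall x, D x -> exists M : R, forall s, A s -> `|G s x| <= M.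

Definition mixture (x : X) : R := \int[nu]_(s in A) G s x.

Lemma mixture_integrable x : D x -> nu.-integrable A (fun s => (G s x)%:E).
Proof. by move=> Dx; have [M GM] := bG Dx; exact: rintegrable_bounded (mG Dx) GM. Qed.

(** The mixture is added to the family that it averages so that a single cubature
serves both. *)
Lemma equicont_mixture : equicont D (mixture |` [set G s | s in A]).
Proof.
move=> x Dx e e0; pose c := fine (nu A) + 1.
have nA0 : 0 <= fine (nu A) by rewrite fine_ge0.
have c0 : 0 < c by rewrite ltr_wpDl.
near=> y.
have H : forall h, [set G s | s in A] h -> `|h y - h x| <= e / c.
  by near: y; apply: eG => //; rewrite divr_gt0.
move=> h [->|/H hyx]; last first.
  by rewrite (le_trans hyx)// ler_pdivrMr// ler_peMr ?lerDr// ltW.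
have Dy : D y by near: y; exact: open_nbhs_nbhs.
have iy := mixture_integrable Dy; have ix := mixture_integrable Dx.
rewrite /mixture -RintegralB//.
apply: le_trans (le_normr_Rintegral mA (rintegrableB mA iy ix)) _.
have iec : nu.-integrable A (EFin \o cst (e / c)).
  exact: (rintegrable_bounded nu mA (measurable_cst (e / c)) (M := `|e / c|)).
apply: le_trans (le_Rintegral mA (integrable_norm (rintegrableB mA iy ix)) iec _) _.
  by move=> s As /=; apply: H; exists s.
rewrite Rintegral_cst// mulrAC ler_pdivrMr// ler_pM2l// lerDl//.
Unshelve. all: by end_near. Qed.

Section against_compact.
Variables (B : set X) (cB : compact B) (BD : B `<=` D).
Variables (m : {finite_measure set (borel X) -> \bar R}) (f : X -> R).
Hypothesis intf : m.-integrable B (EFin \o f : borel X -> \bar R).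

Let Phi (s : S) : R := \int[m]_(x in B) (G s x * f x).
Let I := \int[m]_(x in B) `|f x|.
Let I0 : 0 <= I. Proof. by apply: Rintegral_ge0. Qed.

Let finite_comb (w : seq (R * X)) (s : S) : R := \sum_(p <- w) p.1 * G s p.2.

Let finite_combP w : (forall p, p \in w -> B p.2) ->
  nu.-integrable A (EFin \o finite_comb w) /\
  \int[nu]_(s in A) finite_comb w s = \sum_(p <- w) p.1 * mixture p.2.
Proof.
elim: w => [_|p w IH wB].
  have -> : finite_comb [::] = cst 0 by apply/funext => s; rewrite /finite_comb big_nil.
  split; last by rewrite Rintegral_cst// mul0r big_nil.
  by apply: (rintegrable_bounded nu mA (M := 0)) => // x _; rewrite /= normr0.
have -> : finite_comb (p :: w) = fun s => p.1 * G s p.2 + finite_comb w s.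
  by apply/funext => s; rewrite /finite_comb big_cons.
have [|intw Iw] := IH; first by move=> q qw; apply: wB; rewrite inE qw orbT.
have intp := mixture_integrable (BD (wB p (mem_head p w))).
have intZ := rintegrableZ mA p.1 intp; split; first exact: rintegrableD.
by rewrite RintegralD// Iw big_cons RintegralZl.
Qed.

Let mfinite_comb w : (forall p, p \in w -> B p.2) ->
  measurable_fun A (finite_comb w).
Proof.
by move=> /finite_combP[intw _]; apply/measurable_EFinP; exact: (measurable_int nu intw).
Qed.

(** [Phi] is a uniform limit of finite combinations of the functions [G ^~ x]. *)
Lemma measurable_mixture_integral : measurable_fun A Phi.
Proof.
have e0 N : 0 < (N.+1%:R^-1 : R) by rewrite invr_gt0 ltr0n.
have /choice[w hw] N : exists w : seq (R * X), (forall p, p \in w -> B p.2) /\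
    forall s, A s -> `|Phi s - finite_comb w s| <= N.+1%:R^-1 * I.
  have [w wB hw] := cubature cB BD eG intf (e0 N).
  by exists w; split => // s As; apply: hw; exists s.
apply: (@measurable_fun_cvg _ _ _ A (fun N => finite_comb (w N))).
  by move=> N; apply: mfinite_comb; exact: (hw N).1.
move=> s As; apply/cvgrPdist_le => e ep.
have cI : N.+1%:R^-1 * I @[N --> \oo] --> (0 : R).
  by rewrite -[X in _ --> X](mul0r I); apply: cvgM; [exact: cvg_harmonic|exact: cvg_cst].
have : \forall N \near \oo, N.+1%:R^-1 * I <= e by exact: (cvgr_le _ cI).
by apply: filterS => N; apply: le_trans; exact: (hw N).2.
Qed.

Lemma bounded_mixture_integral : exists M : R, forall s, A s -> `|Phi s| <= M.
Proof.
have [w wB hw] := cubature cB BD eG intf ltr01.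
have /choice[M hM] (x : X) : exists M : R, B x -> forall s, A s -> `|G s x| <= M.
  have [/BD/bG[M hM]|nB] := pselect (B x); first by exists M.
  by exists 0.
exists (I + \sum_(p <- w) `|p.1| * M p.2) => s As.
have := hw (G s) (imageP G As); rewrite mul1r => h.
rewrite -[X in `|X|](subrK (finite_comb w s)) (le_trans (ler_normD _ _))// lerD//.
rewrite (le_trans (ler_norm_sum _ _ _))// big_seq [leRHS]big_seq.
by apply: ler_sum => p pw; rewrite normrM ler_wpM2l//; exact/hM/As/wB.
Qed.

Lemma integrable_mixture_integral : nu.-integrable A (EFin \o Phi).
Proof.
have [M hM] := bounded_mixture_integral.
exact: rintegrable_bounded measurable_mixture_integral hM.
Qed.

(** [G] is measurable in each variable but not known to be jointly measurable.  Fubini's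
theorem is replaced by a cubature: for a finite sum over nodes the exchange is
linearity, and the errors are uniform in [s]. *)
Lemma mixture_fubini :
  \int[nu]_(s in A) Phi s = \int[m]_(x in B) (mixture x * f x).
Proof.
apply/eqP; rewrite -subr_eq0 -normr_le0; apply/ler_addgt0Pr => e e0.
pose c := I * fine (nu A) + I + 1.
have nA0 : 0 <= fine (nu A) by rewrite fine_ge0.
have c0 : 0 < c by rewrite ltr_wpDl// addr_ge0// mulr_ge0.
have ec : 0 < e / c by rewrite divr_gt0.
have [w wB hw] := cubature cB BD equicont_mixture intf ec.
have h1 := hw mixture (or_introl erefl).
have [intw Iw] := finite_combP wB.
have h2 : `|\int[nu]_(s in A) Phi s - \sum_(p <- w) p.1 * mixture p.2| <=
    e / c * I * fine (nu A).
  have intd := rintegrableB mA integrable_mixture_integral intw.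
  rewrite -Iw -RintegralB//; last exact: integrable_mixture_integral.
  have intc : nu.-integrable A (EFin \o cst (e / c * I)).
    exact: (rintegrable_bounded nu mA (measurable_cst (e / c * I)) (M := `|e / c * I|)).
  apply: le_trans (le_normr_Rintegral mA intd) _.
  apply: le_trans (le_Rintegral mA (integrable_norm intd) intc _) _.
    by move=> s As /=; apply: hw; right; exists s.
  by rewrite Rintegral_cst.
rewrite add0r (le_trans (ler_distD (\sum_(p <- w) p.1 * mixture p.2) _ _))//.
rewrite [X in _ + X]distrC (le_trans (lerD h2 h1))//.
rewrite -mulrA -mulrDr mulrAC ler_pdivrMr// ler_pM2l// /c lerDl//.
Qed.

End against_compact.

End mixtures.

End equicontinuity.

(** * Harnack estimates *)

Section kernels.
Context {R : realType} {X : pmetricType R}.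
Variables (U B : set X) (k : X -> X -> R) (cB : compact B).
Hypothesis ck : {within U `*` B, continuous (fun z : X * X => k z.1 z.2)}.

Lemma kernel_near x y (e : R) : U x -> B y -> 0 < e ->
  exists A1 A2 : set X, [/\ nbhs x A1, nbhs y A2 &
    forall z y', A1 z -> A2 y' -> U z -> B y' -> `|k x y - k z y'| < e].
Proof.
move=> Ux By e0; have UBxy : (U `*` B) (x, y) by [].
have /subspace_continuousP/(_ _ UBxy)/cvgrPdist_lt/(_ _ e0) := ck.
move=> [[A1 A2] /= [nA1 nA2] A12]; exists A1, A2; split => // z y' A1z A2y' Uz By'.
by apply: (A12 (z, y')).
Qed.

Lemma kernel_within x : U x -> {within B, continuous (k x)}.
Proof.
move=> Ux; apply/subspace_continuousP => y By; apply/cvgrPdist_lt => e e0.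
have [A1 [A2 [nA1 nA2 A12]]] := kernel_near Ux By e0.
have : nbhs y [set y' | B y' -> `|k x y - k x y'| < e].
  apply: (@filterS _ (nbhs y) _ A2) => // y' A2y' By'.
  by apply: A12 => //; exact: nbhs_singleton.
exact.
Qed.

(** Uniformity in [y] comes from covering the compact set [B] by finitely many
neighbourhoods on which joint continuity controls the kernel. *)
Lemma kernel_equicont x (e : R) : open U -> U x -> 0 < e ->
  \forall z \near x, U z /\ forall y, B y -> `|k z y - k x y| <= e.
Proof.
move=> oU Ux e0.
have nU : \forall z \near x, U z by exact: open_nbhs_nbhs.
suff : \forall z \near x, B `<=` [set y | U z -> `|k z y - k x y| <= e].
  by move=> h; near=> z; split; [near: z|move=> y By; apply: (near h z) => //; near: z].
have /compact_near_coveringP/near_covering_withinP cB' := cB.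
apply: cB' => y By; have e2 : 0 < e / 2 by rewrite divr_gt0.
have [A1 [A2 [nA1 nA2 A12]]] := kernel_near Ux By e2.
exists (A2, A1) => //= -[y' z] /= [A2y' A1z] By' Uz.
have h1 := A12 z y' A1z A2y' Uz By'.
have h2 := A12 x y' (nbhs_singleton nA1) A2y' Ux By'.
rewrite (_ : k z y' - k x y' = (k x y - k x y') - (k x y - k z y')); last by lra.
by rewrite (le_trans (ler_normB _ _))// [leRHS]splitr lerD// ltW.
Unshelve. all: by end_near. Qed.

End kernels.

Section harmonic.
Context {R : realType} {X : pmetricType R}.
Variables (calD : set (set X)) (omega : set X -> X -> probability (borel X) R).
Hypothesis hframe : framework calD omega.
Variables (D : set X) (oD : open D) (x0 : X).
Variable E : nat -> set X.
Hypothesis hE : forall n, [/\ calD (E n), regular (E n) (omega (E n)) &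
                              relcompact (E n) (E n.+1)].
Hypotheses (hE0 : E 0%N x0) (hDE : D = \bigcup_n E n).
Variable KE : nat -> X -> X -> R.
Hypothesis hKE : forall n, continuous_kernel omega (E n) x0 (KE n).

Lemma bd_compact (V W : set X) : relcompact V W -> compact (bd V).
Proof.
move=> [cV _]; apply: (subclosed_compact _ cV); last by move=> x [].
by apply: closedI; [exact: closed_closure|exact: open_closedC (open_interior _)].
Qed.

Lemma bd_sub (V W : set X) : relcompact V W -> bd V `<=` W.
Proof. by move=> [_ VW] x [/VW]. Qed.

Lemma exhaustion_open n : open (E n).
Proof. by have [h _ _] := hframe; have [/h[[]]] := hE n. Qed.

Lemma exhaustion_S n : E n `<=` E n.+1.
Proof. by have [_ _ [_ h]] := hE n; move=> x /subset_closure /h. Qed.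

Lemma exhaustion_le m n : (m <= n)%N -> E m `<=` E n.
Proof.
move=> /subnKC <-; elim: (n - m)%N => [|k IH]; first by rewrite addn0.
by rewrite addnS => x /IH; exact: exhaustion_S.
Qed.

Lemma exhaustion_sub n : E n `<=` D.
Proof. by move=> x En; rewrite hDE; exists n. Qed.

Lemma exhaustion_x0 n : E n x0.
Proof. exact: (exhaustion_le (leq0n n)). Qed.

Lemma exhaustion_relcompact n : relcompact (E n) D.
Proof.
have [_ _ [cE EE]] := hE n.
by split => // x /EE; exact: exhaustion_sub.
Qed.

Lemma compact_bdE n : compact (bd (E n)).
Proof. exact: bd_compact (exhaustion_relcompact n). Qed.

Lemma bdE_sub n : bd (E n) `<=` D.
Proof. exact: bd_sub (exhaustion_relcompact n). Qed.

Lemma omega_bd V x : calD V -> V x -> omega V x (bd V) = 1%E.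
Proof. by have [h _ _] := hframe; move=> /h[_ [_ + _] _ _]; exact. Qed.

Lemma omega_dom V x y : calD V -> V x -> V y -> omega V x `<< omega V y.
Proof. by have [h _ _] := hframe; move=> /h[_ [_ _ +] _ _]; exact. Qed.

Lemma kernel_bdE n x : E n x -> {within bd (E n), continuous (KE n x)}.
Proof. by move=> Ex; exact: (kernel_within (hKE n).1 Ex). Qed.

(** The kernel agrees almost everywhere with the Radon-Nikodym derivative of
[omega (E n) x] with respect to [omega (E n) x0]. *)
Lemma kernel_formula n x g : E n x -> {within bd (E n), continuous g} ->
  \int[omega (E n) x]_(y in bd (E n)) g y =
  \int[omega (E n) x0]_(y in bd (E n)) (KE n x y * g y).
Proof.
move=> Ex cg; have [cE _ _] := hE n.
have cB := @compact_bdE n; have mB := compact_borel cB.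
have dom := omega_dom cE Ex (exhaustion_x0 n).
have intg := integrable_within cB (omega (E n) x) cg.
rewrite /Rintegral; congr fine.
rewrite -(Radon_Nikodym_change_of_variables dom mB intg).
apply: ae_eq_integral => //.
- apply: emeasurable_funM; first exact: (measurable_int _ intg).
  apply: measurable_funTS; apply: measurable_int.
  exact: Radon_Nikodym_integrable.
- apply/measurable_EFinP/measurable_funM; apply: borel_within => //.
  exact: kernel_bdE.
have [_ /(_ x Ex)[N [mN N0 hN]]] := hKE n.
exists N; split => // y /= ny; apply: hN => /= h; apply: ny => By.
by rewrite -h// -EFinM mulrC.
Qed.

Lemma exhaustion_mean n x h : harmonic_on calD omega D h -> E n x ->
  h x = \int[omega (E n) x]_(y in bd (E n)) h y.
Proof.
move=> [_ hh] Ex; have [cE rE _] := hE n.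
by apply: hh => //; exact: exhaustion_relcompact.
Qed.

Lemma harmonic_bdE n h : harmonic_on calD omega D h ->
  {within bd (E n), continuous h}.
Proof. by move=> [ch _]; apply: continuous_subspaceW ch; exact: bdE_sub. Qed.

Lemma harmonic_kernel n x h : harmonic_on calD omega D h -> E n x ->
  h x = \int[omega (E n) x0]_(y in bd (E n)) (KE n x y * h y).
Proof.
move=> hh Ex; rewrite (exhaustion_mean hh Ex); apply: kernel_formula => //.
exact: harmonic_bdE.
Qed.

Definition nonneg_harmonic (M : R) : set (X -> R) :=
  [set h | [/\ harmonic_on calD omega D h, forall x, D x -> 0 <= h x & h x0 <= M]].

Lemma integrable_bdE n h (m : {finite_measure set (borel X) -> \bar R}) :
  harmonic_on calD omega D h -> m.-integrable (bd (E n)) (EFin \o h).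
Proof.
by move=> hh; apply: integrable_within; [exact: compact_bdE|exact: harmonic_bdE].
Qed.

(** The total mass of the positive measure [h * omega (E n) x0] is [h x0]. *)
Lemma harnack_diff n (a : X -> R) (c : R) h : harmonic_on calD omega D h ->
  (forall x, D x -> 0 <= h x) -> {within bd (E n), continuous a} ->
  (forall y, bd (E n) y -> `|a y| <= c) ->
  `|\int[omega (E n) x0]_(y in bd (E n)) (a y * h y)| <= c * h x0.
Proof.
move=> hh h0 ca ac; have cB := @compact_bdE n; have mB := compact_borel cB.
have inth := integrable_bdE n (omega (E n) x0) hh.
have intah := integrable_withinM cB ca inth.
rewrite (exhaustion_mean hh (exhaustion_x0 n)) -RintegralZl//.
apply: le_trans (le_normr_Rintegral mB intah) _.
apply: le_Rintegral => //; first exact: (integrable_norm intah).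
  exact: (rintegrableZ mB c inth).
move=> y By /=; have hy := h0 _ (bdE_sub By).
by rewrite normrM (ger0_norm hy) ler_wpM2r// ac.
Qed.

(** By [harmonic_kernel], [h x] is the integral of the kernel at [x] against a measure
of mass [h x0], and this kernel is bounded on the compact set [bd (E n)]. *)
Lemma harnack_bound x : D x -> exists2 c : R, 0 <= c &
  forall M h, nonneg_harmonic M h -> h x <= c * h x0.
Proof.
rewrite {1}hDE => -[n _ Ex].
have [c c0 hc] := cont_on_bounded (@compact_bdE n) (kernel_bdE Ex).
exists c; first exact: ltW.
move=> M h [hh h0 _]; rewrite (harmonic_kernel hh Ex) (le_trans (ler_norm _))//.
exact: harnack_diff (kernel_bdE Ex) hc.
Qed.

(** The differences of the kernels at [z] and [x] are uniformly small on [bd (E n)]. *)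
Lemma harnack_equicont M : equicont D (nonneg_harmonic M).
Proof.
move=> x Dx e e0; have := Dx; rewrite {1}hDE => -[n _ Ex].
have M0 : 0 < `|M| + 1 by rewrite ltr_wpDl.
have eM : 0 < e / (`|M| + 1) by rewrite divr_gt0.
have := kernel_equicont (@compact_bdE n) (hKE n).1 (@exhaustion_open n) Ex eM.
apply: filterS => z [Ez hz] h [hh h0 hM].
have cd : {within bd (E n), continuous (fun y => KE n z y - KE n x y)}.
  by apply: cont_onB; exact: kernel_bdE.
have inth := integrable_bdE n (omega (E n) x0) hh.
rewrite (harmonic_kernel hh Ez) (harmonic_kernel hh Ex) -RintegralB; last 3 first.
- exact: compact_borel (@compact_bdE n).
- exact: (integrable_withinM (@compact_bdE n) (kernel_bdE Ez) inth).
- exact: (integrable_withinM (@compact_bdE n) (kernel_bdE Ex) inth).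
under eq_Rintegral do rewrite -mulrBl.
apply: le_trans (harnack_diff hh h0 cd hz) _.
rewrite mulrAC ler_pdivrMr// ler_pM2l// (le_trans hM)//.
by rewrite (le_trans (ler_norm M))// lerDl.
Qed.

(** If [h x = 0] then [h] vanishes almost everywhere for the harmonic measure from
[x], hence for the one from [x0], which has the same null sets. *)
Lemma harmonic_minimum h x : harmonic_on calD omega D h ->
  (forall x, D x -> 0 <= h x) -> D x -> h x = 0 -> h x0 = 0.
Proof.
move=> hh h0; rewrite {1}hDE => -[n _ Ex] hx0; have [cE _ _] := hE n.
have mB := compact_borel (@compact_bdE n).
have hB0 y : bd (E n) y -> 0 <= h y by move=> /bdE_sub; exact: h0.
have inth m := integrable_bdE n m hh.
rewrite (exhaustion_mean hh (exhaustion_x0 n)).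
apply/(Rintegral_eq0_ae mB (inth _) hB0).
apply: (null_dominates_ae_eq mB (omega_dom cE (exhaustion_x0 n) Ex)).
by apply/(Rintegral_eq0_ae mB (inth _) hB0); rewrite -(exhaustion_mean hh Ex).
Qed.

End harmonic.

(** * The compact convex set of normalised positive harmonic functions *)

Lemma equicontS {R : realType} {X : pmetricType R} (D : set X) (P Q : set (X -> R)) :
  P `<=` Q -> equicont D Q -> equicont D P.
Proof.
move=> PQ eQ x Dx e e0; have := eQ x Dx e e0.
by apply: filterS => y h g /PQ; exact: h.
Qed.

Section harmonic_limits.
Context {R : realType} {X : pmetricType R}.
Variables (calD : set (set X)) (omega : set X -> X -> probability (borel X) R).
Hypothesis hframe : framework calD omega.
Variables (D : set X) (oD : open D) (x0 : X).
Variable E : nat -> set X.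
Hypothesis hE : forall n, [/\ calD (E n), regular (E n) (omega (E n)) &
                              relcompact (E n) (E n.+1)].
Hypotheses (hE0 : E 0%N x0) (hDE : D = \bigcup_n E n).
Variable KE : nat -> X -> X -> R.
Hypothesis hKE : forall n, continuous_kernel omega (E n) x0 (KE n).

Local Notation H1D := (H1 calD omega D x0).

Let Dx0 : D x0. Proof. by rewrite hDE; exists 0%N. Qed.

Lemma H1_nonneg : H1D `<=` nonneg_harmonic calD omega D x0 1.
Proof. by move=> h [hh hp h1 _]; split => // [x /hp/ltW//|]; rewrite h1. Qed.

Lemma H1_equicont : equicont D H1D.
Proof. exact: equicontS H1_nonneg (harnack_equicont hframe hE hE0 hDE hKE 1). Qed.

Lemma mean_value_cubature (P : set (X -> R)) V x (e : R) : equicont D P ->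
  calD V -> relcompact V D -> V x -> 0 < e ->
  exists2 s : seq (R * X), (forall p, p \in s -> D p.2) &
    forall h, P h ->
      `|\int[omega V x]_(y in bd V) h y - \sum_(p <- s) p.1 * h p.2| <= e.
Proof.
move=> eP cV rV Vx e0; have cB := bd_compact rV; have BD := bd_sub rV.
have mB := compact_borel cB.
have c1 : {within bd V, continuous (fun=> 1 : R)} := @cont_on_cst _ _ (bd V) 1.
have int1 := integrable_within cB (omega V x) c1.
have [s sB hs] := cubature cB BD eP int1 e0.
exists s => [p /sB/BD//|h Ph].
have E1 : \int[omega V x]_(y in bd V) (h y * 1) = \int[omega V x]_(y in bd V) h y.
  by apply: eq_Rintegral => y _; rewrite mulr1.
have := hs h Ph; rewrite E1.
have -> : \int[omega V x]_(y in bd V) `|1| = 1.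
  by rewrite normr1 Rintegral_cst// mul1r [X in fine X](omega_bd hframe cV Vx).
by rewrite mulr1.
Qed.

Lemma relcompact_sub (V W : set X) : relcompact V W -> V `<=` W.
Proof. by move=> [_ VW] x Vx; apply: VW; exact: subset_closure. Qed.

(** A limit along an ultrafilter exists by [harnack_bound].  It is continuous by
equicontinuity, its mean values are controlled by [mean_value_cubature], and it is
strictly positive by [harmonic_minimum] because its value at [x0] is [1]. *)
Lemma H1_compact : compact (H1D : set (ptwise X R)).
Proof.
rewrite compact_ultra => F FU FH.
have /choice[h hF] (x : X) : exists l : R, (fun g : ptwise X R => g x) @ F --> l.
  have [Dx|nDx] := pselect (D x).
    have [c c0 hc] := harnack_bound hframe hE hE0 hDE hKE Dx.
    apply/cvg_ex; apply: (ultra_bounded_cvg (M := c)).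
    apply: (@filterS _ F _ _ _ _ FH) => g gH; have [_ gp g1 _] := gH.
    by rewrite ger0_norm ?(ltW (gp x Dx))// -[leRHS]mulr1 -g1; exact/hc/H1_nonneg.
  exists 0; apply: cvg_near_cst; apply: (@filterS _ F _ _ _ _ FH) => g [_ _ _ g0].
  by rewrite g0.
have FF : Filter F by exact: ultra_proper.
have FP : ProperFilter F by exact: ultra_proper.
exists h; split; last by apply/ptwise_cvgP.
have h_ge0 x : D x -> 0 <= h x.
  move=> Dx; apply: cvgr_to_ge (hF x) _.
  by apply: (@filterS _ F _ _ _ _ FH) => g [_ gp _ _]; exact/ltW/gp.
have hx0 : h x0 = 1.
  apply/eqP; rewrite eq_le; apply/andP; split.
    by apply: cvgr_to_le (hF x0) _; apply: (@filterS _ F _ _ _ _ FH) => g [_ _ -> _].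
  by apply: cvgr_to_ge (hF x0) _; apply: (@filterS _ F _ _ _ _ FH) => g [_ _ -> _].
have hout x : ~ D x -> h x = 0.
  move=> nDx; apply/eqP; rewrite eq_le; apply/andP; split.
    by apply: cvgr_to_le (hF x) _; apply: (@filterS _ F _ _ _ _ FH) => g [_ _ _ ->].
  by apply: cvgr_to_ge (hF x) _; apply: (@filterS _ F _ _ _ _ FH) => g [_ _ _ ->].
have eP : equicont D (h |` H1D).
  move=> x Dx e e0; have := H1_equicont Dx e0; apply: filterS => y hy g [->|/hy//].
  have c1 : `|g y - g x| @[g --> F] --> `|h y - h x|.
    by apply: cvg_norm; apply: cvgB; exact: hF.
  by apply: cvgr_to_le c1 _; apply: (@filterS _ F _ _ _ _ FH) => g' /hy.
have hh : harmonic_on calD omega D h.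
  split; first by apply: (equicont_within eP) => //; left.
  move=> V cV rV relV x Vx; apply/eqP; rewrite -subr_eq0 -normr_le0.
  apply/ler_addgt0Pr => e e0; rewrite add0r.
  have e2 : 0 < e / 2 by rewrite divr_gt0.
  have [s sD hs] := mean_value_cubature eP cV relV Vx e2.
  have h1 := hs h (or_introl erefl).
  pose S (g : X -> R) := \sum_(p <- s) p.1 * g p.2.
  have SF : (fun g : ptwise X R => S g) @ F --> S h.
    rewrite /S; elim: (s) => [|p s' IH].
      rewrite big_nil; apply: cvg_near_cst; apply: filterE => g.
      by rewrite big_nil.
    rewrite big_cons; under eq_fun do rewrite big_cons.
    by apply: cvgD => //; apply: cvgM; [exact: cvg_cst|exact: hF].
  have h2 : `|h x - S h| <= e / 2.
    have c1 : `|g x - S g| @[g --> F] --> `|h x - S h|.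
      by apply: cvg_norm; apply: cvgB => //; exact: hF.
    apply: cvgr_to_le c1 _; apply: (@filterS _ F _ _ _ _ FH) => g Hg.
    by have [gh _ _ _] := Hg; rewrite (gh.2 V)//; apply: hs; right.
  rewrite (_ : h x - _ = (h x - S h) - (\int[omega V x]_(y in bd V) h y - S h)).
    by rewrite (le_trans (ler_normB _ _))// [leRHS]splitr lerD.
  by rewrite opprB addrA subrK.
split => // x Dx; rewrite lt_neqAle h_ge0// andbT eq_sym; apply/eqP => hx.
have := harmonic_minimum hframe hE hE0 hDE hh h_ge0 Dx hx.
by rewrite hx0 => /eqP; rewrite oner_eq0.
Qed.

Lemma H1_convex (a b : ptwise X R) (t : R) : H1D a -> H1D b -> 0 < t < 1 ->
  H1D (fun x => t * a x + (1 - t) * b x).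
Proof.
move=> [ah ap a1 a0] [bh bp b1 b0] /andP[t0 t1]; split.
- split.
    by apply: cont_onD; (apply: cont_onM; first exact: cont_on_cst);
      [exact: ah.1|exact: bh.1].
  move=> V cV rV relV x Vx; have cB := bd_compact relV; have BD := bd_sub relV.
  have mB := compact_borel cB.
  have ia := integrable_within cB (omega V x) (continuous_subspaceW BD ah.1).
  have ib := integrable_within cB (omega V x) (continuous_subspaceW BD bh.1).
  rewrite RintegralD//; [|exact: rintegrableZ|exact: rintegrableZ].
  by rewrite !RintegralZl// -(ah.2 V)// -(bh.2 V).
- by move=> x Dx; rewrite addr_gt0// mulr_gt0 ?subr_gt0 ?ap ?bp.
- by rewrite a1 b1; lra.
- by move=> x nDx; rewrite a0// b0// !mulr0 addr0.
Qed.

(** Finite nets of the compact sets [closure (E n)], for all radii [1 / (j + 1)]. *)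
Lemma dense_sequence : exists2 z : nat -> X, forall k, D (z k) &
  forall x N, D x -> nbhs x N -> exists k, N (z k).
Proof.
have /choice[cs hcs] (nj : nat * nat) : exists cs : seq X,
    (forall c, c \in cs -> closure (E nj.1) c) /\
    forall a, closure (E nj.1) a -> exists2 c, c \in cs & ball c (nj.2.+1%:R^-1 : R) a.
  have [_ _ [cE _]] := hE nj.1.
  apply: (compact_cover_within cE) => c _.
  apply: (@filterS _ (nbhs c) _ (ball c (nj.2.+1%:R^-1 : R))) => //.
  by apply: nbhsx_ballx; rewrite invr_gt0.
have csD nj c : c \in cs nj -> D c.
  by move=> /(hcs nj).1 Ec; have [_] := exhaustion_relcompact hE hDE nj.1; exact.
pose z k := if unpickle k is Some (nj, i) then nth x0 (cs nj) i else x0.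
exists z.
  move=> k; rewrite /z; case: unpickle => [[nj i]|//].
  have [ilt|ige] := ltnP i (size (cs nj)); last by rewrite nth_default.
  by apply: (csD nj); exact: mem_nth.
move=> x N Dx /nbhs_ballP[e /= e0 eN]; have := Dx; rewrite hDE => -[n _ Ex].
pose j := Num.truncn e^-1.
have [c ccs xc] := (hcs (n, j)).2 x (subset_closure Ex).
exists (pickle ((n, j), index c (cs (n, j)))); rewrite /z pickleK nth_index//.
apply: eN; apply: ball_sym; apply: le_ball xc.
by rewrite invf_ple ?posrE// ltW// truncnS_gt.
Qed.

Lemma H1_separated (z : nat -> X) :
  (forall x N, D x -> nbhs x N -> exists k, N (z k)) ->
  forall a b : ptwise X R, H1D a -> H1D b ->
  (forall k, a (z k) = b (z k)) -> a = b.
Proof.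
move=> dz a b Ha Hb ab; apply/funext => x.
have [Dx|nDx] := pselect (D x); last first.
  by have [_ _ _ ->] := Ha => //; have [_ _ _ ->] := Hb.
apply/eqP; rewrite -subr_eq0 -normr_le0; apply/ler_addgt0Pr => e e0; rewrite add0r.
have e2 : 0 < e / 2 by rewrite divr_gt0.
have [k hk] := dz x _ Dx (H1_equicont Dx e2).
have h1 := hk a Ha; have h2 := hk b Hb; rewrite ab in h1.
rewrite (_ : a x - b x = (b (z k) - b x) - (b (z k) - a x)); last by lra.
by rewrite (le_trans (ler_normB _ _))// [leRHS]splitr lerD.
Qed.

End harmonic_limits.

(** * Densities and image measures *)

Section set_function_integral.
Import HBNNSimple.

(** For integrals against a set function that is only known to agree with a measure on
measurable sets. *)
Lemma eq_set_function_integral {d} {T : measurableType d} {R : realType}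
    (m1 m2 : set T -> \bar R) (D : set T) (f g : T -> \bar R) :
  (forall A, measurable A -> m1 A = m2 A) -> (forall x, D x -> f x = g x) ->
  (\int[m1]_(x in D) f x = \int[m2]_(x in D) g x)%E.
Proof.
move=> m12 fg; rewrite /integral (_ : f \_ D = g \_ D); last first.
  by apply/funext => x; rewrite !patchE; case: ifPn => // /set_mem/fg.
by congr (ereal_sup _ - ereal_sup _)%E; apply/seteqP; split => _ [h hf <-];
  (exists h => //; apply: eq_fsbigr => r _; rewrite m12//).
Qed.

End set_function_integral.

Section density.
Context {d} {T : measurableType d} {R : realType}.
Variables (w : {finite_measure set T -> \bar R}) (g : T -> R).
Hypotheses (g0 : forall x, 0 <= g x) (intg : w.-integrable setT (EFin \o g)).
Local Open Scope ereal_scope.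

Definition density (A : set T) : \bar R := \int[w]_(x in A) (g x)%:E.

Let density0 : density set0 = 0. Proof. exact: integral_set0. Qed.

Let density_ge0 A : 0 <= density A.
Proof. by apply: integral_ge0 => x _; rewrite lee_fin. Qed.

Let density_additive : semi_sigma_additive density.
Proof.
apply: semi_sigma_additive_nng_induced; first exact: (measurable_int w intg).
by move=> x; rewrite lee_fin.
Qed.

HB.instance Definition _ := isMeasure.Build _ _ _ density
  density0 density_ge0 density_additive.

Let density_fin : fin_num_fun density.
Proof.
move=> A mA; apply: integrable_fin_num => //.
by apply: integrableS intg.
Qed.

HB.instance Definition _ := Measure_isFinite.Build _ _ _ density density_fin.

(** [g] is the Radon-Nikodym derivative of the density measure. *)
Lemma density_integral (A : set T) (f : T -> R) : measurable A ->
  density.-integrable A (EFin \o f) ->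
  \int[density]_(x in A) (f x)%:E = \int[w]_(x in A) (f x * g x)%:E.
Proof.
move=> mA intf; have mg := measurable_int w intg.
have dom : density `<< w.
  apply/null_content_dominatesP => B mB wB.
  by rewrite /density null_set_integral//; exact: measurable_funTS.
pose m := [the {finite_measure set T -> \bar R} of density].
have RN : ae_eq w setT (Radon_Nikodym (charge_of_finite_measure m) w) (EFin \o g).
  apply: integral_ae_eq => //; first exact: Radon_Nikodym_integrable.
  by move=> B _ mB; rewrite -Radon_Nikodym_integral.
have := @Radon_Nikodym_change_of_variables _ _ _ m w dom (EFin \o f) A mA intf.
move=> <-; apply: ae_eq_integral => //.
- apply: emeasurable_funM; first exact: (measurable_int _ intf).
  by apply: measurable_funTS; apply: measurable_int; exact: Radon_Nikodym_integrable.
- apply/measurable_EFinP/measurable_funM.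
    by apply/measurable_EFinP; exact: (measurable_int _ intf).
  by apply/measurable_EFinP; exact: measurable_funTS.
case: RN => N [mN N0 hN]; exists N; split => // x /= nx; apply: hN => /= h.
by apply: nx => _; rewrite h// EFinM.
Qed.

Lemma density_measure : exists m : {finite_measure set T -> \bar R},
  (forall A, m A = density A) /\
  forall A (f : T -> R), measurable A -> m.-integrable A (EFin \o f) ->
    \int[m]_(x in A) (f x)%:E = \int[w]_(x in A) (f x * g x)%:E.
Proof.
exists density; split => // A f mA intf; exact: density_integral.
Qed.

End density.

Section pushforward_density.
Context {d d'} {T : measurableType d} {S : measurableType d'} {R : realType}.
Variables (w : {finite_measure set T -> \bar R}) (B : set T) (mB : measurable B).
Variables (g : T -> R) (i : T -> S).
Hypotheses (g0 : forall x, B x -> 0 <= g x).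
Hypotheses (intg : w.-integrable B (EFin \o g)) (mi : measurable_fun B i).
Local Open Scope ereal_scope.

(** The functions [g], [i] and [f] are controlled only on [B] and [Y]; they are extended
trivially, and the resulting measures coincide as set functions with those of the
statement. *)
Lemma integral_pushforward_density (Y : set S) (f : S -> R) (M : R) :
  measurable Y -> (forall x, B x -> Y (i x)) -> measurable_fun Y f ->
  (forall y, Y y -> (`|f y| <= M)%R) ->
  \int[pushforward (fun A => \int[w]_(x in B `&` A) (g x)%:E) i]_(y in Y) (f y)%:E =
  \int[w]_(x in B) (f (i x) * g x)%:E.
Proof.
move=> mY iY mf fM.
pose G := g \_ B.
have G0 x : (0 <= G x)%R by rewrite /G patchE; case: ifPn => // /set_mem/g0.
have GE : EFin \o G = (EFin \o g) \_ B by rewrite restrict_EFin.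
have intG : w.-integrable setT (EFin \o G).
  by rewrite GE; apply/(integrable_mkcond _ mB).
have [m [mE mI]] := density_measure G0 intG.
pose i' := i \_ B; pose F := f \_ Y.
have mi' : measurable_fun setT i' by exact: (measurable_restrictT _ mB).1.
have mF : measurable_fun setT F by exact: (measurable_restrictT _ mY).1.
have i'E x : B x -> i' x = i x by move=> Bx; rewrite /i' patchE mem_set.
have FE y : Y y -> F y = f y by move=> Yy; rewrite /F patchE mem_set.
have FM y : (`|F y| <= `|M|)%R.
  rewrite /F patchE; case: ifPn => [/set_mem/fM h|_]; last by rewrite normr0.
  exact: le_trans h (ler_norm _).
have mY' : measurable (i' @^-1` Y) by rewrite -[X in measurable X]setTI; exact: mi'.
have mFi : measurable_fun (i' @^-1` Y) (F \o i').
  by apply: measurable_funTS; exact: measurableT_comp.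
have intFi : m.-integrable (i' @^-1` Y) (EFin \o (F \o i')).
  by apply: (rintegrable_bounded m mY' mFi) => x _; exact: FM.
rewrite (@eq_set_function_integral _ _ _ _ (pushforward m i') _ _ (EFin \o F));
    last 2 first.
- move=> A mA; rewrite /pushforward mE /density.
  rewrite [RHS](eq_integral ((EFin \o g) \_ B)); last first.
    by move=> x _; exact: (congr1 (fun h => h x) GE).
  rewrite -integral_mkcondr (_ : i' @^-1` A `&` B = B `&` i @^-1` A)//.
  apply/seteqP; split => x [] /=; first by move=> + Bx; rewrite i'E.
  by move=> Bx iA; rewrite i'E.
- by move=> y Yy; rewrite /= FE.
rewrite integral_pushforward//; last by apply/measurable_EFinP.
rewrite [LHS]mI//.
rewrite (eq_integral ((fun x => (f (i x) * g x)%:E) \_ B)); last first.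
  move=> x _; rewrite [RHS]patchE /G; case: ifPn => xB.
    by rewrite patchE xB /= i'E ?FE//; [exact/iY/set_mem|exact/set_mem].
  by rewrite patchE (negbTE xB) mulr0.
rewrite -integral_mkcondr (_ : i' @^-1` Y `&` B = B)//.
by apply/seteqP; split => [x []//|x Bx]; split => //=; rewrite i'E//; exact: iY.
Qed.

End pushforward_density.

Section image_measure.
Context {d d'} {T : measurableType d} {S : measurableType d'} {R : realType}.
Variables (w : {finite_measure set T -> \bar R}) (B : set T) (mB : measurable B).
Variables (i : T -> S) (mi : measurable_fun B i).
Local Open Scope ereal_scope.

(** The image of the restriction of [w] to [B]. *)
Definition image_on (A : set S) : \bar R := w (B `&` i @^-1` A).

Let image0 : image_on set0 = 0.
Proof. by rewrite /image_on preimage_set0 setI0 measure0. Qed.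

Let image_ge0 A : 0 <= image_on A. Proof. exact: measure_ge0. Qed.

Let image_additive : semi_sigma_additive image_on.
Proof.
move=> F mF tF mUF; rewrite /image_on preimage_bigcup setI_bigcupr.
apply: measure_semi_sigma_additive.
- by move=> n; exact: mi.
- apply/trivIsetP => /= j k _ _ jk; rewrite setIACA setIid -preimage_setI.
  by move/trivIsetP : tF => /(_ _ _ _ _ jk) ->//; rewrite preimage_set0 setI0.
- by rewrite -setI_bigcupr -preimage_bigcup; exact: mi.
Qed.

HB.instance Definition _ := isMeasure.Build _ _ _ image_on
  image0 image_ge0 image_additive.

Let image_fin : fin_num_fun image_on.
Proof. by move=> A mA; apply: fin_num_measure; exact: mi. Qed.

HB.instance Definition _ := Measure_isFinite.Build _ _ _ image_on image_fin.

Lemma image_measure : exists m : {finite_measure set S -> \bar R},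
  (forall A, m A = w (B `&` i @^-1` A)) /\
  forall (Y : set S) (f : S -> R) (M : R), measurable Y ->
    (forall x, B x -> Y (i x)) -> measurable_fun Y f ->
    (forall y, Y y -> (`|f y| <= M)%R) ->
    (\int[m]_(y in Y) f y)%R = (\int[w]_(x in B) f (i x))%R.
Proof.
exists image_on; split => // Y f M mY iY mf fM; rewrite /Rintegral; congr fine.
have int1 : w.-integrable B (EFin \o cst 1%R).
  by apply: (rintegrable_bounded w mB (M := 1%R)) => // x _; rewrite normr1.
have H := integral_pushforward_density mB (fun x _ => ler01) int1 mi mY iY mf fM.
transitivity (\int[w]_(x in B) (f (i x) * cst 1%R x)%:E); last first.
  by apply: eq_integral => x _; rewrite mulr1.
rewrite -H; apply: eq_set_function_integral => // A mA.
rewrite /image_on /pushforward integral_cst ?mul1e//; exact: mi.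
Qed.

End image_measure.

(** * Representation on the minimal boundary *)

Lemma compactification_continuous {X : topologicalType} {K : topologicalType}
    (D : set X) (i : X -> K) : open D -> compactification D i ->
  forall x, D x -> {for x, continuous i}.
Proof.
move=> oD [_ _ _ _ hi] x Dx V; rewrite nbhsE => -[W [oW Wx] WV].
have [_ /(_ (ex_intro2 _ _ W oW erefl))[V' oV' VD]] := hi (D `&` i @^-1` W).
have : nbhs x (D `&` V').
  apply: open_nbhs_nbhs; split; first exact: openI.
  by rewrite VD.
by rewrite VD; apply: filterS => y [_ /WV].
Qed.

Lemma measurable_eval_compact_conv {R : realType} {X : pmetricType R} (D : set X)
    (x : X) : D x ->
  measurable_fun setT (fun h : borel (compact_conv D) => (h : X -> R) x).
Proof.
move=> Dx.
have ce : continuous (fun h : compact_conv D => (h : X -> R) x).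
  move=> h; have /fam_cvgP/(_ [set x]) := @cvg_id _ (nbhs h).
  rewrite uniform_set1; apply; split; first exact: compact_set1.
  by move=> _ ->.
apply: (borel_within (A := setT)) => //; exact: continuous_subspaceT.
Qed.

Lemma image_measurable_within {X K : ptopologicalType} (B : set X) (i : X -> K) :
  measurable (B : set (borel X)) -> {within B, continuous i} ->
  measurable_fun (B : set (borel X)) (i : borel X -> borel K).
Proof.
move=> mB ci; apply: borel_into => // V oV.
move/continuousP : ci => /(_ _ oV); rewrite open_subspaceP => -[W oW WB].
by rewrite setIC -[X in measurable X]WB; apply: measurableI => //; exact: borel_open.
Qed.

Section boundary.
Context {R : realType} {X : pmetricType R}.
Variables (calD : set (set X)) (omega : set X -> X -> probability (borel X) R).
Hypothesis hframe : framework calD omega.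
Variables (D : set X) (oD : open D) (x0 : X).
Variable E : nat -> set X.
Hypothesis hE : forall n, [/\ calD (E n), regular (E n) (omega (E n)) &
                              relcompact (E n) (E n.+1)].
Hypotheses (hE0 : E 0%N x0) (hDE : D = \bigcup_n E n).
Variable KE : nat -> X -> X -> R.
Hypothesis hKE : forall n, continuous_kernel omega (E n) x0 (KE n).
Variables (DK : pmetricType R) (iK : X -> DK) (hiK : compactification D iK).
Variables (dmK : set (borel DK)) (mdmK : measurable dmK).
Variable kappa : DK -> X -> R.
Hypothesis hkappa : set_bij dmK (extremal_harmonic calD omega D x0) kappa.
Hypothesis mkappa :
  measurable_fun dmK (kappa : borel DK -> borel (compact_conv D)).
Variables (s : nat -> nat).
Hypothesis hconv : forall eta : DK, dmK eta ->
  weak_cvg setT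
    (fun n => pushforward
       (density_on (omega (E (s n)) x0) (bd (E (s n))) (kappa eta))
       (iK : borel X -> borel DK))
    (dirac (eta : borel DK)).

Local Notation H1D := (H1 calD omega D x0).
Local Notation w n := (omega (E (s n)) x0).
Local Notation B n := (bd (E (s n))).

Let Dx0 : D x0. Proof. by rewrite hDE; exists 0%N. Qed.

Let cB n : compact (B n). Proof. exact: (compact_bdE hE hDE). Qed.
Let mB n : measurable (B n : set (borel X)). Proof. exact: (compact_borel (@cB n)). Qed.
Let BD n : B n `<=` D. Proof. exact: (bdE_sub hE hDE). Qed.

Let eH1 : equicont D H1D.
Proof. exact: (H1_equicont hframe hE hE0 hDE hKE). Qed.

Lemma H1_bounded x : D x -> exists M : R, forall h, H1D h -> `|h x| <= M.
Proof.
move=> Dx; have [c c0 hc] := harnack_bound hframe hE hE0 hDE hKE Dx.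
exists c => h Hh; have [_ hp h1 _] := Hh.
by rewrite ger0_norm ?(ltW (hp x Dx))// -[leRHS]mulr1 -h1; exact/hc/H1_nonneg.
Qed.

Lemma kappa_H1 eta : dmK eta -> H1D (kappa eta).
Proof. by have [hf _ _] := hkappa; move=> /hf[]. Qed.

Lemma kappa_equicont : equicont D [set kappa eta | eta in dmK].
Proof. by apply: equicontS eH1 => _ [eta deta <-]; exact: kappa_H1. Qed.

Lemma kappa_measurable x : D x -> measurable_fun dmK (fun eta => kappa eta x).
Proof.
by move=> Dx; exact: (measurableT_comp (measurable_eval_compact_conv Dx) mkappa).
Qed.

Lemma kappa_bounded x : D x ->
  exists M : R, forall eta, dmK eta -> `|kappa eta x| <= M.
Proof.
by move=> /H1_bounded[M hM]; exists M => eta deta; exact/hM/kappa_H1.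
Qed.

Lemma iK_within n : {within B n, continuous iK}.
Proof.
apply/subspace_continuousP => x Bx; apply: cvg_within_filter.
by apply: (compactification_continuous oD hiK); exact: BD Bx.
Qed.

Lemma iK_measurable n : measurable_fun (B n : set (borel X)) (iK : borel X -> borel DK).
Proof. exact: (image_measurable_within (@mB n) (@iK_within n)). Qed.

Lemma compact_DK : compact [set: DK]. Proof. by have [h _ _ _ _] := hiK. Qed.

Lemma continuous_bounded (f : DK -> R) : continuous f ->
  exists2 M : R, 0 < M & forall y, `|f y| <= M.
Proof.
move=> cf; have [M M0 fM] := cont_on_bounded compact_DK (continuous_subspaceT cf).
by exists M => // y; exact: fM.
Qed.

Lemma test_within n (f : DK -> R) : continuous f ->
  {within B n, continuous (f \o iK)}.
Proof. by move=> cf x; apply: (continuous_comp (@iK_within n x)); exact: cf. Qed.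

Lemma pushforward_harmonic n (h : X -> R) (f : DK -> R) :
  {within B n, continuous h} -> (forall x, D x -> 0 <= h x) -> continuous f ->
  (\int[pushforward (density_on (w n) (B n) h) (iK : borel X -> borel DK)]_(y in setT)
     (f y)%:E = (\int[w n]_(x in B n) (h x * f (iK x)))%:E)%E.
Proof.
move=> ch h0 cf; have [M M0 fM] := continuous_bounded cf.
have inth := integrable_within (@cB n) (w n) ch.
have mf : measurable_fun [set: borel DK] (f : borel DK -> R).
  by apply: borel_within => //; exact: continuous_subspaceT.
have := integral_pushforward_density (@mB n) (fun x Bx => h0 x (BD Bx)) inth
  (@iK_measurable n) measurableT (fun _ _ => I) mf (fun y _ => fM y).
move=> ->; rewrite -EFin_Rintegral//; last first.
  exact: (integrable_withinM (@cB n) ch (integrable_within (@cB n) (w n) (test_within cf))).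
by apply: eq_integral => x _; rewrite mulrC.
Qed.

(** The convergence to a point mass at [eta], tested against [f]. *)
Lemma kappa_limit eta (f : DK -> R) : dmK eta -> continuous f ->
  \int[w n]_(x in B n) (kappa eta x * f (iK x)) @[n --> \oo] --> f eta.
Proof.
move=> deta cf; have Hk := kappa_H1 deta; have [hh hp _ _] := Hk.
have := hconv deta (continuous_subspaceT cf).
rewrite integral_dirac//; last first.
  by apply/measurable_EFinP; apply: borel_within => //; exact: continuous_subspaceT.
rewrite diracT mul1e.
have pE n := pushforward_harmonic (harmonic_bdE hE hDE hh (n := s n))
  (fun x Dx => ltW (hp x Dx)) cf.
under eq_fun do rewrite pE.
by move=> /fine_cvgP[_]; exact.
Qed.

(** After exchanging the integrals the integrand converges to [f] by [kappa_limit];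
it is bounded by the supremum of [f] because [kappa eta x0 = 1]. *)
Lemma mixture_limit (nu : {finite_measure set (borel DK) -> \bar R}) (f : DK -> R) :
  continuous f ->
  \int[w n]_(x in B n) (mixture nu dmK kappa x * f (iK x)) @[n --> \oo] -->
  \int[nu]_(eta in dmK) f eta.
Proof.
move=> cf; have [M M0 fM] := continuous_bounded cf.
have intf n := integrable_within (@cB n) (w n) (test_within cf).
have E1 n : \int[w n]_(x in B n) (mixture nu dmK kappa x * f (iK x)) =
    \int[nu]_(eta in dmK) \int[w n]_(x in B n) (kappa eta x * f (iK x)).
  by rewrite (mixture_fubini nu mdmK oD kappa_equicont kappa_measurable
    kappa_bounded (@cB n) (@BD n) (intf n)).
under eq_fun do rewrite E1.
have := @bounded_cvg _ (borel DK) R nu dmK mdmK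
  (fun n eta => \int[w n]_(x in B n) (kappa eta x * f (iK x))) f M.
move=> [].
- move=> n; exact: (measurable_mixture_integral nu mdmK kappa_equicont
    kappa_measurable kappa_bounded (@cB n) (@BD n) (intf n)).
- by move=> eta deta; exact: kappa_limit.
- move=> n eta deta; have [hh hp h1 _] := kappa_H1 deta.
  have := harnack_diff hE hE0 hDE (n := s n) (h := kappa eta) hh
    (fun x Dx => ltW (hp x Dx)) (test_within cf) (fun y _ => fM (iK y)).
  rewrite h1 mulr1; congr (`|_| <= _); apply: eq_Rintegral => x _; exact: mulrC.
- by [].
Qed.

Section mixtures_of_kernels.
Variable nu : {finite_measure set (borel DK) -> \bar R}.
Let v := mixture nu dmK kappa.

Lemma mixture_harmonic : harmonic_on calD omega D v.
Proof.
have ev := equicont_mixture nu mdmK oD kappa_equicont kappa_measurable kappa_bounded.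
split; first by apply: (equicont_within ev) => //; left.
move=> V cV rV relV x Vx; have cbd := bd_compact relV; have bdD := bd_sub relV.
have c1 : {within bd V, continuous (fun=> 1 : R)} := @cont_on_cst _ _ (bd V) 1.
have int1 := integrable_within cbd (omega V x) c1.
have := mixture_fubini nu mdmK oD kappa_equicont kappa_measurable
    kappa_bounded cbd bdD int1.
rewrite -/v; have -> : \int[omega V x]_(y in bd V) (v y * 1) =
    \int[omega V x]_(y in bd V) v y by apply: eq_Rintegral => y _; rewrite mulr1.
move=> <-; apply: eq_Rintegral => eta /set_mem deta.
have [[_ hh] _ _ _] := kappa_H1 deta; rewrite (hh V cV rV relV x Vx).
by apply: eq_Rintegral => y _; rewrite mulr1.
Qed.

Lemma mixture_x0 : v x0 = fine (nu dmK).
Proof.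
rewrite /v /mixture -[RHS]mul1r -Rintegral_cst//; apply: eq_Rintegral => eta /set_mem deta.
by have [_ _ -> _] := kappa_H1 deta.
Qed.

Lemma mixture_ge0 x : D x -> 0 <= v x.
Proof.
move=> Dx; apply: Rintegral_ge0 => eta deta.
by have [_ hp _ _] := kappa_H1 deta; exact/ltW/hp.
Qed.

(** By [harmonic_minimum] a zero of the mixture would force its value at [x0], the total
mass, to be zero. *)
Lemma mixture_gt0 x : nu dmK != 0%E -> D x -> 0 < v x.
Proof.
move=> nu0 Dx; rewrite lt_neqAle mixture_ge0// andbT eq_sym; apply/eqP => vx.
have := harmonic_minimum hframe hE hE0 hDE mixture_harmonic mixture_ge0 Dx vx.
move: nu0; rewrite mixture_x0 => /negP nu0 vx0; apply: nu0.
by rewrite -[X in X == _]fineK ?fin_num_measure// vx0.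
Qed.

Lemma mixture_EFin x : D x ->
  (\int[nu]_(eta in dmK) (kappa eta x)%:E = (v x)%:E)%E.
Proof.
move=> Dx; apply: EFin_Rintegral => //.
exact: (mixture_integrable nu mdmK kappa_measurable kappa_bounded Dx).
Qed.

End mixtures_of_kernels.

(** Choquet's theorem yields a representation at the points of a sequence only. *)
Lemma harmonic_eq_dense (z : nat -> X) (g h : X -> R) :
  (forall x N, D x -> nbhs x N -> exists k, N (z k)) ->
  {within D, continuous g} -> {within D, continuous h} ->
  (forall k, g (z k) = h (z k)) -> forall x, D x -> g x = h x.
Proof.
move=> dz cg ch gh x Dx; apply/eqP; rewrite -subr_eq0 -normr_le0.
apply/ler_addgt0Pr => e e0; rewrite add0r.
have cgh : {within D, continuous (fun y => g y - h y)} := cont_onB cg ch.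
move: cgh; rewrite continuous_open_subspace// => /(_ x (mem_set Dx)).
move=> /cvgrPdist_le/(_ e e0)/(dz x _ Dx)[k /=].
by rewrite gh subrr subr0.
Qed.

(** The measure given by Choquet's theorem is carried to [dmK] by the inverse [th] of
[kappa].  An open set of [DK] is the set where some continuous [phi] does not
vanish, and the function [phi \o th] is measurable because [kappa_limit] writes it
as a limit of integrals that are measurable in [a = kappa eta]. *)
Lemma H1_representation u : H1D u ->
  exists nu : {finite_measure set (borel DK) -> \bar R},
    nu (~` dmK) = 0%E /\ forall x, D x -> u x = mixture nu dmK kappa x.
Proof.
move=> Hu.
have [z zD dz] := dense_sequence hE hE0 hDE.
have cH1 := H1_compact hframe hE hE0 hDE hKE.
have [m [A [[mA mA0] Aext mA1 mz]]] :=
  @choquet R X (H1D : set (ptwise X R)) z cH1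
   (fun a b t Ha Hb ht => H1_convex Ha Hb ht) (H1_separated hframe hE hE0 hDE hKE dz) u Hu.
have AH1 a : A a -> H1D a by move=> /Aext[].
have /choice[th hth] (a : ptwise X R) : exists eta : DK,
    A a -> dmK eta /\ kappa eta = a.
  have [Aa|nA] := pselect (A a); last by exists point.
  have [_ _ /(_ a (Aext a Aa))[eta deta e]] := hkappa.
  by exists eta.
have eA : equicont D [set (a : X -> R) | a in A].
  by apply: equicontS eH1 => _ [a Aa <-]; exact: AH1.
have meA x : D x -> measurable_fun A (fun a : baire R (H1D : set (ptwise X R)) => (a : X -> R) x).
  move=> Dx; apply: measurable_funTS; apply: measurable_cont_on.
  by apply: continuous_subspaceT; exact: ptwise_eval_continuous.
have bA x : D x -> exists M : R, forall a : baire R (H1D : set (ptwise X R)), A a -> `|(a : X -> R) x| <= M.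
  by move=> /H1_bounded[M hM]; exists M => a /AH1; exact: hM.
have mth : measurable_fun A (th : baire R (H1D : set (ptwise X R)) -> borel DK).
  apply: borel_into => // V oV.
  have [phi [cphi phi0 phiV]] := closed_zero_set (open_closedC oV).
  have mphi : measurable_fun A (phi \o th : baire R (H1D : set (ptwise X R)) -> R).
    apply: (@measurable_fun_cvg _ _ _ A (fun n (a : baire R (H1D : set (ptwise X R))) =>
        \int[w n]_(y in B n) ((a : X -> R) y * phi (iK y)))).
      move=> n; exact: (measurable_mixture_integral m mA eA meA bA (@cB n) (@BD n)
        (integrable_within (@cB n) (w n) (test_within cphi))).
    move=> a Aa; have [deta ka] := hth a Aa.
    by have := kappa_limit deta cphi; rewrite ka.
  have -> : A `&` th @^-1` V = A `&` (phi \o th) @^-1` (~` [set 0]).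
    apply/seteqP; split => a [Aa /= h]; split => //=.
      by move=> /phiV; exact.
    by apply: contrapT => /phiV.
  by apply: mphi => //; apply: measurableC; exact: measurable_set1.
have [nu [nuE nuI]] := image_measure m mA mth.
have nudm : nu (~` dmK) = 0%E.
  rewrite nuE (_ : A `&` th @^-1` (~` dmK) = set0) ?measure0//.
  by apply/seteqP; split => // a [/= /hth[]].
exists nu; split => //.
have [ch _] := mixture_harmonic nu.
apply: (harmonic_eq_dense dz) => //; first by have [[]] := Hu.
move=> k; have [M hM] := kappa_bounded (zD k).
have [intk <-] := mz k.
rewrite /mixture (nuI dmK (fun eta => kappa eta (z k)) M)//.
- apply: eq_Rintegral => a /set_mem Aa; by have [_ ->] := hth a Aa.
- by move=> a /hth[].
- exact: kappa_measurable (zD k).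
Qed.

(** Apply [H1_representation] to [u / u x0], extended by zero, and multiply the measure
by [u x0]. *)
Lemma harmonic_representation u : harmonic_on calD omega D u ->
  (forall x, D x -> 0 < u x) ->
  exists nu : {finite_measure set (borel DK) -> \bar R},
    nu (~` dmK) = 0%E /\ forall x, D x -> u x = mixture nu dmK kappa x.
Proof.
move=> hu u_gt0; have c0 := u_gt0 x0 Dx0.
pose h x := if pselect (D x) is left _ then (u x0)^-1 * u x else 0.
have hE' x : D x -> h x = (u x0)^-1 * u x by rewrite /h; case: pselect.
have Hh : H1D h.
  split.
  - split.
      have ch : {within D, continuous (fun x => (u x0)^-1 * u x)}.
        by apply: cont_onM; [exact: cont_on_cst|exact: hu.1].
      apply/subspace_continuousP => x Dx; rewrite /from_subspace hE'//.
      move/subspace_continuousP : ch => /(_ x Dx); apply: cvg_trans.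
      apply: near_eq_cvg; near=> y; rewrite /from_subspace hE'//.
      by near: y; exact: withinT.
    move=> V cV rV relV x Vx; have VD := relcompact_sub relV.
    have cbd := bd_compact relV; have bdD := bd_sub relV.
    rewrite hE'; last exact: VD.
    rewrite (hu.2 V cV rV relV x Vx) -RintegralZl; last 2 first.
    + exact: compact_borel cbd.
    + apply: (integrable_within cbd); exact: continuous_subspaceW bdD hu.1.
    by apply: eq_Rintegral => y /set_mem /bdD Dy; rewrite hE'.
  - by move=> x Dx; rewrite hE'// mulr_gt0 ?invr_gt0 ?u_gt0.
  - by rewrite hE'// mulVf// gt_eqF.
  - by move=> x nDx; rewrite /h; case: pselect.
have [nu [nu0 nuh]] := H1_representation Hh.
have intc : nu.-integrable setT (EFin \o (fun=> u x0)).
  exact: (rintegrable_bounded nu measurableT (M := `|u x0|)).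
have [m [mE mI]] := density_measure (fun=> ltW c0) intc.
exists m; split.
  rewrite mE /density null_set_integral//; exact: measurableC.
move=> x Dx; have [M hM] := kappa_bounded Dx.
have mk := kappa_measurable Dx.
rewrite /mixture /Rintegral mI//; last exact: (rintegrable_bounded m mdmK mk hM).
have intk := rintegrable_bounded nu mdmK mk hM.
rewrite -[RHS]/(\int[nu]_(eta in dmK) (kappa eta x * u x0)) RintegralZr//.
by rewrite -[X in X * _]/(mixture nu dmK kappa x) -nuh// hE'// mulrAC mulVf ?mul1r// gt_eqF.
Unshelve. all: by end_near. Qed.

(** Any representing measure is the weak limit of [u * omega (D_ n) x0]; hence its
uniqueness, and the convergence of the full sequence. *)
Lemma representation_limit u (nu : {finite_measure set (borel DK) -> \bar R})
    (f : DK -> R) :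
  (forall x, D x -> u x = mixture nu dmK kappa x) -> continuous f ->
  \int[w n]_(x in B n) (u x * f (iK x)) @[n --> \oo] --> \int[nu]_(eta in dmK) f eta.
Proof.
move=> unu cf; have := @mixture_limit nu f cf.
have E1 n : \int[w n]_(x in B n) (mixture nu dmK kappa x * f (iK x)) =
    \int[w n]_(x in B n) (u x * f (iK x)).
  by apply: eq_Rintegral => x /set_mem /BD Dx; rewrite unu.
by under eq_fun do rewrite E1.
Qed.

Lemma carried_Rintegral (nu : {finite_measure set (borel DK) -> \bar R}) (f : DK -> R) :
  nu (~` dmK) = 0%E -> continuous f ->
  \int[nu]_eta f eta = \int[nu]_(eta in dmK) f eta.
Proof.
move=> nu0 cf; have [M M0 fM] := continuous_bounded cf.
have mf : measurable_fun [set: borel DK] (f : borel DK -> R).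
  by apply: borel_within => //; exact: continuous_subspaceT.
apply: Rintegral_carried => //.
exact: (rintegrable_bounded nu measurableT mf (fun y _ => fM y)).
Qed.

Lemma representation_unique u (nu1 nu2 : {finite_measure set (borel DK) -> \bar R}) :
  nu1 (~` dmK) = 0%E -> nu2 (~` dmK) = 0%E ->
  (forall x, D x -> u x = mixture nu1 dmK kappa x) ->
  (forall x, D x -> u x = mixture nu2 dmK kappa x) ->
  forall A, measurable A -> nu1 A = nu2 A.
Proof.
move=> n1 n2 u1 u2; apply: finite_measure_unique => f cf _.
rewrite !carried_Rintegral//.
by apply: (cvg_unique _ (representation_limit u1 cf) (representation_limit u2 cf));
  exact: Rhausdorff.
Qed.

End boundary.

(** * Weak limits on the common refinement *)

Lemma homo_ltn_ge (phi : nat -> nat) : {homo phi : m n / (m < n)%N} ->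
  forall n, (n <= phi n)%N.
Proof. by move=> hphi; elim=> // n IH; rewrite (leq_ltn_trans IH)// hphi. Qed.

Lemma homo_ltn_cvg (phi : nat -> nat) : {homo phi : m n / (m < n)%N} ->
  phi @ \oo --> \oo.
Proof.
move=> hphi A [N _ NA]; exists N => // n /= Nn; apply: NA.
exact: leq_trans (homo_ltn_ge hphi n).
Qed.

Lemma carried_setI d (T : measurableType d) (R : realType)
    (m : {measure set T -> \bar R}) (S A : set T) :
  measurable S -> m (~` S) = 0%E -> measurable A -> m (S `&` A) = m A.
Proof.
move=> mS mS0 mA; rewrite (measureDI m mA mS) setIC.
rewrite [X in (X + _)%E](@subset_measure0 _ _ _ m _ (~` S)) ?add0e//.
- exact: measurableD.
- exact: measurableC.
Qed.

Theorem corollary4p17 (R : realType) (X : pmetricType R)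
    (calD : set (set X)) (omega : set X -> X -> probability (borel X) R)
    (hframe : framework calD omega)
    (D : set X) (hD : domain D) (x0 : X) (hx0 : D x0)
    (* the exhaustion and its relative kernels *)
    (E : nat -> set X)
    (hE : forall n, [/\ calD (E n), regular (E n) (omega (E n)) &
                        relcompact (E n) (E n.+1)])
    (hE0 : E 0%N x0) (hDE : D = \bigcup_n E n)
    (KE : nat -> X -> X -> R)
    (hKE : forall n, continuous_kernel omega (E n) x0 (KE n))
    (* the compactification DK, its minimal boundary and the kernel K_D *)
    (DK : pmetricType R) (iK : X -> DK) (hiK : compactification D iK)
    (dmK : set (borel DK)) (mdmK : measurable dmK)
    (hdmK : dmK `<=` ~` (iK @` D))
    (kappa : DK -> X -> R)
    (hkappa : set_bij dmK (extremal_harmonic calD omega D x0) kappa)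
    (mkappa : measurable_fun dmK (kappa : borel DK -> borel (compact_conv D)))
    (* the subsequence, relabelled as D_ *)
    (s : nat -> nat) (hs : {homo s : m n / (m < n)%N})
    (D_ := E \o s) (K_ := KE \o s) (K_D := fun x eta => kappa eta x)
    (hconv : forall eta : DK, dmK eta ->
      weak_cvg setT
        (fun n => pushforward
           (density_on (omega (D_ n) x0) (bd (D_ n)) (fun x => K_D x eta))
           (iK : borel X -> borel DK))
        (dirac (eta : borel DK)))
    (* the compactification DG and the common refinement *)
    (DG : pmetricType R) (iG : X -> DG) (hiG : compactification D iG)
    (Dhat : set (borel (DG * DK)%type) := refinement D iG iK)
    (pK : borel (DG * DK)%type -> borel DK := snd)
    (dmhat := Dhat `&` pK @^-1` dmK)
    (Khat_D := fun x (eta : borel (DG * DK)%type) => K_D x (pK eta))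
    (* the positive harmonic function u and the weak limit *)
    (u : X -> R) (hu : harmonic_on calD omega D u) (u_gt0 : forall x, D x -> 0 < u x)
    (lambda := fun n => density_on (omega (D_ n) x0) (bd (D_ n)) u)
    (lambdahat := fun n =>
       pushforward (lambda n) (diag iG iK : borel X -> borel (DG * DK)%type))
    (muhat : {finite_measure set (borel (DG * DK)%type) -> \bar R})
    (hmuhat : carried muhat Dhat) (hlim : weak_limit Dhat lambdahat muhat)
    (mu := pushforward muhat pK)
    (B := fun n x => (\int[lambda n]_(y in bd (D_ n)) (K_ n x y)%:E)%E) :
  [/\
    (* 1 *)
    [/\ carried muhat dmhat /\ carried mu dmK,
        forall x, D x -> (u x)%:E = (\int[mu]_(eta in dmK) (K_D x eta)%:E)%E,
        mu dmK = (u x0)%:E &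
        forall nu : {finite_measure set (borel DK) -> \bar R},
          carried nu dmK ->
          (forall x, D x -> (u x)%:E = (\int[nu]_(eta in dmK) (K_D x eta)%:E)%E) ->
          forall A, measurable A -> nu A = mu A],
    (* 2 *)
    forall nu : {finite_measure set (borel DK) -> \bar R},
      carried nu dmK -> nu setT != 0%E ->
      let v := fun x => (\int[nu]_(eta in dmK) (K_D x eta)%:E)%E in
      (forall x, D x -> (0 < v x < +oo)%E) /\
      harmonic_on calD omega D (fun x => fine (v x)),
    (* 3 *)
    (forall nuhat : {finite_measure set (borel (DG * DK)%type) -> \bar R},
       radon nuhat -> carried nuhat dmhat ->
       ((forall x, D x ->
           (u x)%:E = (\int[nuhat]_(eta in dmhat) (Khat_D x eta)%:E)%E) <->
        (forall A, measurable A -> pushforward nuhat pK A = mu A))) /\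
    (forall muhat' : {finite_measure set (borel (DG * DK)%type) -> \bar R},
       carried muhat' Dhat -> weak_limit Dhat lambdahat muhat' ->
       forall A, measurable A -> pushforward muhat' pK A = mu A),
    (* 4 *)
    weak_cvg setT (fun n => pushforward (lambdahat n) pK) mu /\
    weak_cvg setT
      (fun n => pushforward (lambda n) (iK : borel X -> borel DK)) mu &
    (* 5 *)
    [/\ forall n, lambdahat n Dhat = (u x0)%:E,
        forall n x, D_ n x -> B n x = (u x)%:E &
        loc_unif_cvg D D_ (fun n x => fine (B n x)) u]].
Proof.
have [_ _ oD] := hD.
have Ex0 n : E n x0 by exact: (exhaustion_x0 hE hE0).
have cB n : compact (bd (D_ n)) by exact: (compact_bdE hE hDE).
have mB n : measurable (bd (D_ n) : set (borel X)) by exact: (compact_borel (@cB n)).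
have BD n : bd (D_ n) `<=` D by exact: (bdE_sub hE hDE).
have [nu [nu0 nuu]] := harmonic_representation hframe oD hE hE0 hDE hKE hiK mdmK
  hkappa mkappa hconv hu u_gt0.
have ulim := representation_limit hframe oD hE hE0 hDE hKE hiK mdmK hkappa mkappa
  hconv nuu.
have uniq := representation_unique hframe oD hE hE0 hDE hKE hiK mdmK hkappa mkappa
  hconv.
have mixE := mixture_EFin hframe hE hE0 hDE hKE mdmK hkappa mkappa.
have ciG := compactification_continuous oD hiG.
have ciK := compactification_continuous oD hiK.
have cdiag n : {within bd (D_ n), continuous (diag iG iK)}.
  apply/subspace_continuousP => x Bx; apply: cvg_within_filter.
  have Dx := BD n x Bx.
  exact: (cvg_pair (ciG x Dx) (ciK x Dx)).
have mdiag n : measurable_fun (bd (D_ n) : set (borel X))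
    (diag iG iK : borel X -> borel (DG * DK)%type).
  exact: image_measurable_within (@mB n) (@cdiag n).
have miK n := iK_measurable oD hE hDE hiK (n := s n).
have diagD x : D x -> Dhat (diag iG iK x).
  by move=> Dx; apply: subset_closure; exists x.
have mDhat : measurable Dhat by apply: borel_closed; exact: closed_closure.
have cpK : continuous (snd : DG * DK -> DK) by move=> p; exact: cvg_snd.
have mpK : measurable_fun [set: borel (DG * DK)%type] pK.
  apply: image_measurable_within => //; exact: continuous_subspaceT.
have mpKV (A : set (borel DK)) : measurable A -> measurable (pK @^-1` A).
  by move=> mA; rewrite -[X in measurable X]setTI; exact: mpK.
have u0 x : D x -> 0 <= u x by move=> /u_gt0/ltW.
have intu n := integrable_bdE hE hDE (s n) (omega (D_ n) x0) hu.
have fM := continuous_bounded hiK.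
have mf (f : DK -> R) : continuous f -> measurable_fun [set: borel DK] (f : borel DK -> R).
  by move=> cf; apply: borel_within => //; exact: continuous_subspaceT.
have int_uf n (f : DK -> R) : continuous f -> (omega (D_ n) x0).-integrable
    (bd (D_ n)) (EFin \o (fun x => u x * f (iK x)) : borel X -> \bar R).
  move=> cf; apply: (integrable_withinM (cB n)); first exact: (harmonic_bdE hE hDE hu).
  exact: (integrable_within (cB n) _ (test_within oD hE hDE hiK cf)).
(* A test function on [DK] composed with the projection is one on the refinement, so
   the image of a weak limit integrates it as [nu] does. *)
have proj (mh : {finite_measure set (borel (DG * DK)%type) -> \bar R}) :
    carried mh Dhat -> weak_limit Dhat lambdahat mh ->
    forall A, measurable A -> pushforward mh pK A = nu A.
  move=> mhD [phi hphi mhlim] A mA.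
  have [m [mE mI]] := image_measure mh measurableT mpK.
  have -> : pushforward mh pK A = m A by rewrite mE setTI.
  move: A mA; apply: finite_measure_unique => f cf _.
  have [M M0 fMM] := fM f cf.
  have mfs : measurable_fun [set: borel (DG * DK)%type] (f \o snd).
    by apply: (@borel_within R (DG * DK)%type setT) => //;
      apply: continuous_subspaceT => p; apply: continuous_comp; [exact: cpK|exact: cf].
  have intfs := rintegrable_bounded mh measurableT mfs (fun y _ => fMM _).
  have intfsD := rintegrable_bounded mh mDhat (measurable_funTS mfs) (fun y _ => fMM _).
  rewrite (mI setT f M)//; last exact: mf.
  rewrite (carried_Rintegral hiK mdmK nu0 cf).
  rewrite (Rintegral_carried mDhat mhD intfs).
  have c1 : {within (Dhat : set (DG * DK)), continuous (f \o snd)}.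
    by apply: continuous_subspaceT => p; apply: continuous_comp; [exact: cpK|exact: cf].
  have := mhlim _ c1.
  have lE n : (\int[(lambdahat \o phi) n]_(y in Dhat) ((f \o snd) y)%:E =
      (\int[omega (D_ (phi n)) x0]_(x in bd (D_ (phi n))) (u x * f (iK x)))%:E)%E.
    rewrite [LHS](integral_pushforward_density (@mB (phi n)) (fun x Bx => u0 x (BD _ x Bx))
      (intu (phi n)) (@mdiag (phi n)) mDhat (fun x Bx => diagD x (BD _ x Bx))
      (measurable_funTS mfs) (fun y _ => fMM _)).
    rewrite -EFin_Rintegral//; last exact: int_uf.
    by apply: eq_integral => x _; rewrite mulrC.
  under eq_fun do rewrite lE.
  rewrite (EFin_Rintegral mDhat intfsD) => /fine_cvgP[_ h1].
  have h2 : (\int[omega (D_ (phi n)) x0]_(x in bd (D_ (phi n))) (u x * f (iK x)))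
      @[n --> \oo] --> \int[nu]_(eta in dmK) f eta.
    apply: (cvg_comp phi (fun n => \int[omega (D_ n) x0]_(x in bd (D_ n)) (u x * f (iK x))) (homo_ltn_cvg hphi)).
    exact: ulim.
  exact: (cvg_unique (@Rhausdorff R) h1 h2).
have muE : forall A, measurable A -> mu A = nu A by exact: proj.
have nu_x0 : nu dmK = (u x0)%:E.
  rewrite nuu// (mixture_x0 mdmK hkappa) fineK//; exact: fin_num_measure.
have mu_int x : (\int[mu]_(eta in dmK) (K_D x eta)%:E =
    \int[nu]_(eta in dmK) (K_D x eta)%:E)%E.
  exact: eq_set_function_integral.
have mCdmK : measurable (~` dmK) by exact: measurableC.
have repr_mixture (m : {finite_measure set (borel DK) -> \bar R}) :
    (forall x, D x -> (u x)%:E = (\int[m]_(eta in dmK) (K_D x eta)%:E)%E) ->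
    forall x, D x -> u x = mixture m dmK kappa x.
  by move=> mu_r x Dx; have := mu_r x Dx; rewrite mixE// => -[].
(* [Khat_D] factors through [pK], so representing [u] depends on the image only. *)
have image_hat (nuhat : {finite_measure set (borel (DG * DK)%type) -> \bar R}) :
    carried nuhat dmhat -> exists m : {finite_measure set (borel DK) -> \bar R},
      [/\ m (~` dmK) = 0%E,
          forall A, measurable A -> m A = pushforward nuhat pK A &
          forall x, D x -> (\int[nuhat]_(eta in dmhat) (Khat_D x eta)%:E =
                            \int[m]_(eta in dmK) (K_D x eta)%:E)%E].
  move=> nuhat0.
  have mdmhat : measurable dmhat by apply: measurableI => //; exact: mpKV.
  have mpK' : measurable_fun dmhat pK by exact: measurable_funTS.
  have [m [mE mI]] := image_measure nuhat mdmhat mpK'.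
  exists m; split.
  - rewrite mE (_ : dmhat `&` pK @^-1` (~` dmK) = set0) ?measure0//.
    by apply/seteqP; split => // y [[_ /= h]].
  - move=> A mA; rewrite mE; apply: carried_setI => //; exact: mpKV.
  - move=> x Dx; have [M hM] := kappa_bounded hframe hE hE0 hDE hKE hkappa Dx.
    have mk := kappa_measurable mkappa Dx.
    have mk' : measurable_fun dmhat (Khat_D x).
      apply: (measurable_comp mdmK _ mk mpK').
      by move=> _ [y [_ ?] <-].
    have sub : dmhat `<=` pK @^-1` dmK by move=> y [].
    rewrite mixE// [mixture _ _ _ _](mI dmK (kappa ^~ x) M)//.
    have := rintegrable_bounded nuhat mdmhat mk' (fun y (dy : dmhat y) => hM _ (sub y dy)).
    by move/(EFin_Rintegral mdmhat).
split.
- split.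
  + split.
      have mdmhat : measurable dmhat by apply: measurableI => //; exact: mpKV.
      rewrite /carried setCI; apply/eqP; rewrite -measure_le0.
      rewrite (le_trans (measureU2 _ _ _))//; try exact: measurableC.
        by apply: measurableC; exact: mpKV.
      rewrite [X in (X + _)%E]hmuhat add0e.
      have : mu (~` dmK) = 0%E by rewrite muE.
      by rewrite /mu /pushforward preimage_setC => /eqP; rewrite eq_le => /andP[].
    by rewrite /carried muE.
  + by move=> x Dx; rewrite mu_int mixE// nuu.
  + by rewrite muE.
  + move=> nu' nu'0 nu'r A mA; rewrite muE//.
    exact: (uniq u nu' nu nu'0 nu0 (repr_mixture _ nu'r) nuu A mA).
- move=> nu' nu'0 nu'T v; split; last exact: mixture_harmonic.
  move=> x Dx; rewrite /v mixE// ltry andbT lte_fin.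
  apply: (mixture_gt0 hframe oD hE hE0 hDE hKE mdmK hkappa mkappa) => //.
  apply: contra_neq nu'T => nu'd; rewrite -(setUv dmK) measureU//; last by rewrite setICr.
  by rewrite [X in (X + _)%E]nu'd [X in (_ + X)%E](_ : _ = 0%E) ?adde0.
- split; last first.
    by move=> muhat' h1 h2 A mA; rewrite (proj _ h1 h2)// muE.
  move=> nuhat _ nuhat0; have [m [m0 mE mI]] := image_hat nuhat nuhat0.
  split => [nur A mA|nur x Dx].
    rewrite -mE// muE//; apply: (uniq u m nu m0 nu0 _ nuu A mA).
    by apply: repr_mixture => x Dx; rewrite nur// mI.
  rewrite mI// (@eq_set_function_integral _ _ _ m nu _ _ (fun eta => (K_D x eta)%:E))//.
    by rewrite mixE// nuu.
  by move=> A mA; rewrite mE// nur// muE.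
- have weak : weak_cvg setT
      (fun n => pushforward (lambda n) (iK : borel X -> borel DK)) mu.
    move=> f /(continuous_subspace_setT (f : DK -> R)) cf.
    have [M M0 fMM] := fM f cf.
    have muf : (\int[mu]_(y in setT) (f y)%:E = (\int[nu]_(eta in dmK) f eta)%:E)%E.
      rewrite (@eq_set_function_integral _ _ _ mu nu _ _ (fun eta => (f eta)%:E))//.
      rewrite EFin_Rintegral//; last exact: (rintegrable_bounded nu measurableT (mf f cf) (fun y _ => fMM y)).
      by rewrite (carried_Rintegral hiK mdmK nu0 cf).
    have pE n := pushforward_harmonic oD x0 hE hDE hiK
      (harmonic_bdE hE hDE hu (n := s n)) u0 cf.
    under eq_fun do rewrite pE.
    rewrite muf; apply: cvg_EFin; first exact: nearW.
    exact: ulim.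
  by split.
- have BE n x : D_ n x -> B n x = (u x)%:E.
    move=> Ex; rewrite /B /lambda.
    have ck := kernel_bdE hKE Ex.
    have [M M0 hM] := cont_on_bounded (cB n) ck.
    have mk := borel_within (mB n) ck.
    have mid : measurable_fun (bd (D_ n) : set (borel X)) (@id (borel X)) by exact: measurable_id.
    rewrite [LHS](integral_pushforward_density (@mB n) (fun x Bx => u0 x (BD _ x Bx))
      (intu n) mid (mB n) (fun x Bx => Bx) mk hM).
    rewrite (harmonic_kernel hframe hE hE0 hDE hKE hu Ex).
    by apply: EFin_Rintegral => //; exact: (integrable_withinM (cB n) ck (intu n)).
  split.
  + move=> n; rewrite /lambdahat /pushforward /lambda /density_on.
    rewrite (_ : bd (D_ n) `&` diag iG iK @^-1` Dhat = bd (D_ n)).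
      by rewrite EFin_Rintegral// -(exhaustion_mean hE hDE hu (Ex0 (s n))).
    by apply/seteqP; split => [x []//|x Bx]; split => //; apply: diagD; exact: BD Bx.
  + exact: BE.
  + move=> x Dx; have := Dx; rewrite {1}hDE => -[m _ Ex].
    exists (E m); first by apply: open_nbhs_nbhs; split => //; exact: (exhaustion_open hframe hE).
    move=> e e0; exists m => // n /= mn z Ez.
    have Dnz : D_ n z.
      apply: (exhaustion_le hE _ Ez).
      exact: leq_trans mn (homo_ltn_ge hs n).
    by split => //; rewrite BE// subrr normr0.
Qed.
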